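(* Let $(X,\|\cdot\|)$ be a Banach space, $T:X\to X$ a nonexpansive map, $f:[0,\infty)\to X$ a continuous function, $x_0\in X$, and let $u:[0,\infty)\to X$ be the unique solution of $$u'(t)+(I-T)u(t)=f(t),\qquad u(0)=x_0.$$ Let $\epsilon:[0,\infty)\to[0,\infty)$ be a continuous function with $\epsilon(t)\ge\|f(t)\|$ for all $t\ge0$. Assume that one of the following two conditions holds, with $\kappa$ defined accordingly: (i) $T$ has bounded range, and $\kappa=\sup\{\|Tx-x_0\|:x\in X\}$; or (ii) $\mathrm{Fix}(T)\ne\emptyset$, $\epsilon(\cdot)$ is decreasing (i.e. nonincreasing) with $S=\int_0^\infty\epsilon(t)\,dt<\infty$, and $\kappa=2\,\mathrm{dist}(x_0,\mathrm{Fix}(T))+S$. Then, for all $t\ge0$, $$\|u'(t)\|\le\kappa\,\sigma(t)+\int_0^t2\,\epsilon(s)\,\sigma(t-s)\,ds+\epsilon(t).$$ Moreover, if $\epsilon(t)\to0$ as $t\to\infty$ and $\int_0^\infty\epsilon(s)\,ds<\infty$, then $\|u'(t)\|\to0$ as $t\to\infty$.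
   Context: $T$ nonexpansive means $\|Tx-Ty\|\le\|x-y\|$ for all $x,y\in X$; $\mathrm{Fix}(T)=\{x\in X:Tx=x\}$; $I$ is the identity map. The function $\sigma:[0,\infty)\to\mathbb{R}$ is $\sigma(y)=\min\{1,1/\sqrt{\pi y}\}$, with $\sigma(0)=1$. *)

(* Defs.v *)
From HB Require Import structures.
From mathcomp Require Import all_boot all_order all_algebra.
From mathcomp Require Import all_classical all_reals all_analysis.
Set Implicit Arguments.
Unset Strict Implicit.
Unset Printing Implicit Defensive.
Import Order.TTheory GRing.Theory Num.Theory numFieldNormedType.Exports.
Local Open Scope classical_set_scope.
Local Open Scope ring_scope.

(* The value at 0 is fixed explicitly since [0^-1 = 0] in MathComp; [sigma] is
   only meaningful on the half-line [0, +oo[. *)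
Definition sigma (R : realType) (y : R) : R :=
  if y == 0 then 1 else Num.min 1 (Num.sqrt (pi * y))^-1.

Definition nonexpansive (R : realType) (X : normedModType R) (T : X -> X) :=
  forall x y : X, `|T x - T y| <= `|x - y|.

Definition Fix (X : Type) (T : X -> X) : set X := [set x | T x = x].

Definition dist_set (R : realType) (X : normedModType R) (x : X) (A : set X) : R :=
  inf [set `|x - y| | y in A].

(* Functions on the closed half-line [0, +oo[ are encoded as functions on the
   whole of R whose values at negative arguments are irrelevant.  Accordingly
   the derivative is the limit of difference quotients taken inside the
   half-line: the right derivative at 0, the usual one at positive points. *)
Definition quotient_within (R : realType) (X : normedModType R)
    (u : R -> X) (t : R) : set_system X :=
  (s - t)^-1 *: (u s - u t) @[s --> within `[0, +oo[ t^'].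

Definition derivable_within (R : realType) (X : normedModType R)
    (u : R -> X) (t : R) : Prop :=
  cvg (quotient_within u t).

Definition derive_within (R : realType) (X : normedModType R)
    (u : R -> X) (t : R) : X :=
  lim (quotient_within u t).

Definition is_solution (R : realType) (X : normedModType R) (T : X -> X)
    (f : R -> X) (x0 : X) (u : R -> X) : Prop :=
  u 0 = x0 /\
  forall t : R, 0 <= t ->
    derivable_within u t /\ derive_within u t + (u t - T (u t)) = f t.

Definition bounded_range_case (R : realType) (X : normedModType R) (T : X -> X)
    (x0 : X) (kappa : R) : Prop :=
  bounded_set (range T) /\ kappa = sup [set `|T x - x0| | x in [set: X]].

Definition integrable_halfline (R : realType) (eps : R -> R) : Prop :=
  (\int[lebesgue_measure]_(t in `[0%R, +oo[) (eps t)%:E < +oo)%E.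

Definition fixed_point_case (R : realType) (X : normedModType R) (T : X -> X)
    (x0 : X) (eps : R -> R) (kappa : R) : Prop :=
  [/\ Fix T !=set0,
      (forall s t : R, 0 <= s -> s <= t -> eps t <= eps s),
      integrable_halfline eps
    & kappa = 2 * dist_set x0 (Fix T)
              + \int[lebesgue_measure]_(t in `[0, +oo[) eps t].

(* Main.v *)
Require Import Defs.
From HB Require Import structures.
From mathcomp Require Import all_boot all_order all_algebra.
From mathcomp Require Import all_classical all_reals all_analysis.
From mathcomp Require Import measurable_realfun.
From mathcomp Require Import ring lra.
Set Implicit Arguments.
Unset Strict Implicit.
Unset Printing Implicit Defensive.
Import Order.TTheory GRing.Theory Num.Theory numFieldNormedType.Exports.
Local Open Scope classical_set_scope.
Local Open Scope ring_scope.

(** The solution satisfies u' = (T u - u) + f, so that u relaxes towards its image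
    under the nonexpansive map T at unit rate.  The proof bounds the two families
    of distances

      phi(s, t) = |u t - u s|   and   psi(s, t) = |u s - T (u t)|   (s <= t)

    by functions d = [increment_bound] and q = [image_bound] which solve the
    linear system obtained by replacing every inequality by an equality:

      d_t d + d = q + eps t,   d = 0 for s = t,
      d_s q + q = d + eps s,   q >= kappa for s = 0.

    That d and q are indeed bounds is a contraction argument ([increment_le]).
    If phi <= d + delta for s <= t <= A, then psi <= q + delta, since T is
    nonexpansive, and then phi <= d + (1 - e^(-A)) delta
    ([damped_comparison]); iterating, phi <= d.  The boundary condition needs
    |T (u t) - x0| <= kappa, which holds by definition in the bounded range case,
    and which follows, in the fixed point case, from
    |u t - p| <= |x0 - p| + int_0^t eps for every fixed point p
    ([fixed_point_distance]).

    The system is solved explicitly.  Without source term, d = kappa F and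
    q = kappa G, where F and G are kernels with d_t F = W = G - F and
    d_s G = - W, F = 0 for s = t and G = 1 for s = 0.  With the
    source term, a solution is

      d(s, t) = kappa F(s, t) + 2 int_0^s eps r F(s - r, t - r) dr
                + int_s^t eps.

    Since d vanishes on the diagonal, letting t decrease to s in phi <= d gives
    ([velocity_le])

      |u' t| <= kappa W(t, t) + 2 int_0^t eps r W(t - r, t - r) dr + eps t.

    The function W(t, t) is e^(-2t) (I_0(2t) + I_1(2t)), I_0 and I_1 being the
    modified Bessel functions, and it is at most sigma t
    ([Wker_diag_le_sigma]); the constant 1 / sqrt (pi t) comes from the Gaussian
    integral.  The convergence to 0 follows from this estimate, by splitting the
    convolution of eps and sigma at t / 2 ([sigma_convolution_cvg0]). *)

(** * Slopes and a mean value inequality *)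

(** [has_slope g a b c l] says that [g] is differentiable at [c] relatively to
    the segment [[a, b]], with derivative [l].  It is phrased with increments
    over intervals [[x, y]] straddling [c], which makes one-sided derivatives at
    the end points and the mean value inequality uniform. *)
Definition has_slope {R : realType} {V : normedModType R} (g : R -> V)
    (a b c : R) (l : V) : Prop :=
  forall e : R, 0 < e -> exists2 r : R, 0 < r &
    forall x y : R, a <= x -> x <= c -> c <= y -> y <= b -> y - x < r ->
      `|g y - g x - (y - x) *: l| <= e * (y - x).

Section slopes.
Context {R : realType} {V : normedModType R}.
Implicit Types (g : R -> V) (a b c : R) (l : V).

Lemma has_slopeD g1 g2 a b c l1 l2 : has_slope g1 a b c l1 ->
  has_slope g2 a b c l2 ->
  has_slope (fun t => g1 t + g2 t) a b c (l1 + l2).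
Proof.
move=> s1 s2 e e0.
have e20 : 0 < e / 2 by rewrite divr_gt0.
have [r1 r10 h1] := s1 _ e20; have [r2 r20 h2] := s2 _ e20.
exists (Num.min r1 r2) => [|x y ax xc cy yb]; first by rewrite lt_min r10.
rewrite lt_min => /andP[yr1 yr2].
have -> : g1 y + g2 y - (g1 x + g2 x) - (y - x) *: (l1 + l2) =
    (g1 y - g1 x - (y - x) *: l1) + (g2 y - g2 x - (y - x) *: l2).
  by rewrite scalerDr !opprD [RHS]addrACA; congr (_ + _); rewrite addrACA.
apply: (le_trans (ler_normD _ _)).
rewrite [e]splitr mulrDl lerD //; [exact: h1|exact: h2].
Qed.

Lemma has_slopeZ k g a b c l : has_slope g a b c l ->
  has_slope (fun t => k *: g t) a b c (k *: l).
Proof.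
move=> s e e0.
have k0 : 0 < `|k| + 1 by rewrite ltr_wpDl.
have [r r0 h] := s _ (divr_gt0 e0 k0).
exists r => // x y ax xc cy yb yr.
rewrite scalerA mulrC -scalerA -!scalerBr normrZ.
have xy : 0 <= y - x by rewrite subr_ge0 (le_trans xc).
apply: (le_trans (ler_wpM2l (normr_ge0 k) (h x y ax xc cy yb yr))).
rewrite mulrA ler_wpM2r // mulrCA ler_piMr ?(ltW e0) //.
by rewrite ler_pdivrMr // mul1r lerDl.
Qed.

Lemma has_slope_cst (v : V) a b c : has_slope (fun=> v) a b c (0 : V).
Proof.
move=> e e0; exists 1 => // x y _ xc cy _ _.
by rewrite subrr scaler0 subrr normr0 mulr_ge0 ?(ltW e0) ?subr_ge0 ?(le_trans xc).
Qed.

Lemma has_slope_quadratic C g a b c l :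
  (forall x y, a <= x -> x <= c -> c <= y -> y <= b ->
    `|g y - g x - (y - x) *: l| <= C * (y - x) ^+ 2) ->
  has_slope g a b c l.
Proof.
move=> gC e e0.
have C0 : 0 < `|C| + 1 by rewrite ltr_wpDl.
exists (e / (`|C| + 1)) => [|x y ax xc cy yb yr]; first exact: divr_gt0.
have xy : 0 <= y - x by rewrite subr_ge0 (le_trans xc).
apply: (le_trans (gC x y ax xc cy yb)); rewrite expr2 mulrA ler_wpM2r //.
rewrite ltr_pdivlMr // in yr.
apply: le_trans (ltW yr); rewrite mulrC ler_wpM2l //.
by rewrite (le_trans (ler_norm C)) // lerDl.
Qed.

Lemma has_slope_continuous g a b c l : a <= c -> c <= b ->
  has_slope g a b c l ->
  forall e, 0 < e -> exists2 r, 0 < r &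
    forall y, a <= y -> y <= b -> `|y - c| < r -> `|g y - g c| <= e.
Proof.
move=> ac cb s e e0; have [r r0 h] := s 1 ltr01.
have l0 : 0 < `|l| + 1 by rewrite ltr_wpDl.
exists (Num.min r (e / (`|l| + 1))) => [|y ay yb].
  by rewrite lt_min r0 divr_gt0.
rewrite lt_min => /andP[yr ye].
have main x z : a <= x -> x <= c -> c <= z -> z <= b -> z - x < r ->
    z - x < e / (`|l| + 1) -> `|g z - g x| <= e.
  move=> ax xc cz zb zr ze.
  have xz : 0 <= z - x by rewrite subr_ge0 (le_trans xc).
  have := h x z ax xc cz zb zr.
  rewrite mul1r => hxz.
  have -> : g z - g x = (g z - g x - (z - x) *: l) + (z - x) *: l.
    by rewrite subrK.
  apply: (le_trans (ler_normD _ _)).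
  rewrite normrZ (ger0_norm xz).
  rewrite ltr_pdivlMr // mulrDr mulr1 in ze.
  by rewrite (le_trans _ (ltW ze)) // addrC lerD2l.
have [cy|/ltW yc] := leP c y.
  by apply: main => //; rewrite -[y - c]ger0_norm ?subr_ge0.
by rewrite distrC; apply: main => //; rewrite -[c - y]ger0_norm ?subr_ge0 // distrC.
Qed.

(** The usual expansion at [c] gives the straddling one. *)
Lemma has_slope_at g a b c l : a <= c -> c <= b ->
  (forall e, 0 < e -> exists2 r, 0 < r &
    forall y, a <= y -> y <= b -> `|y - c| < r ->
      `|g y - g c - (y - c) *: l| <= e * `|y - c|) ->
  has_slope g a b c l.
Proof.
move=> ac cb H e e0; have [r r0 h] := H _ e0.
exists r => // x y ax xc cy yb yr.
have -> : g y - g x - (y - x) *: l =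
    (g y - g c - (y - c) *: l) - (g x - g c - (x - c) *: l).
  have -> : (y - x) *: l = (y - c) *: l - (x - c) *: l.
    by rewrite -scalerBl opprB addrA subrK.
  rewrite [- (g x - g c - _)]opprD [RHS]addrACA -[- _ - - _]opprD.
  by rewrite [- (g x - g c)]opprB addrA subrK.
have yc0 : 0 <= y - c by rewrite subr_ge0.
have cx0 : 0 <= c - x by rewrite subr_ge0.
have hy := h y (le_trans ac cy) yb.
have hx := h x ax (le_trans xc cb).
rewrite (ger0_norm yc0) in hy; rewrite distrC (ger0_norm cx0) in hx.
apply: (le_trans (ler_normB _ _)).
have -> : e * (y - x) = e * (y - c) + e * (c - x) by ring.
apply: lerD; [apply: hy|apply: hx]; lra.
Qed.

Lemma has_slope_subset g a b c l a' b' : a <= a' -> b' <= b ->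
  has_slope g a b c l -> has_slope g a' b' c l.
Proof.
move=> aa bb s e e0; have [r r0 h] := s e e0.
exists r => // x y ax xc cy yb yr; apply: h => //.
  exact: le_trans ax.
exact: le_trans bb.
Qed.

(** A mean value inequality for a vector-valued [g], dominated by a real [h].
    The supremum of the points up to which the inequality holds (with slack
    [e]) cannot be smaller than [b], since the local hypothesis at the supremum
    carries the inequality past it. *)
Lemma mean_value_inequality g (h : R -> R) a b : a <= b ->
  (forall c, a <= c -> c <= b -> forall e, 0 < e -> exists2 r, 0 < r &
    forall x y, a <= x -> x <= c -> c <= y -> y <= b -> y - x < r ->
      `|g y - g x| <= h y - h x + e * (y - x)) ->
  `|g b - g a| <= h b - h a.
Proof.
move=> ab H.
suff K e : 0 < e -> `|g b - g a| <= h b - h a + e * (b - a).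
  have [<-|nab] := eqVneq a b; first by rewrite !subrr normr0.
  have ba : 0 < b - a by rewrite subr_gt0 lt_neqAle nab.
  apply/ler_addgt0Pr => e e0.
  have := K _ (divr_gt0 e0 ba); rewrite mulfVK //.
  by rewrite gt_eqF.
move=> e0.
pose S : set R := [set x | [/\ a <= x, x <= b & 
   `|g x - g a| <= h x - h a + e * (x - a)]].
have Sa : S a by split => //; rewrite !subrr normr0 mulr0 addr0.
have Sub : has_ubound S by exists b => x [].
have supS : has_sup S by split => //; exists a.
pose c := sup S.
have ac : a <= c by apply: ub_le_sup.
have cb : c <= b by apply: ge_sup => [|x []//]; exists a.
have [r r0 hr] := H c ac cb e e0.
have [x Sx xc] := sup_adherent r0 supS.
have [ax xb gx] := Sx.
have xc' : x <= c by apply: ub_le_sup.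
rewrite -/c in xc.
have Sy y : c <= y -> y <= b -> y - x < r -> S y.
  move=> cy yb yr; split => //; first exact: le_trans cy.
  have -> : g y - g a = (g y - g x) + (g x - g a) by rewrite addrA subrK.
  apply: (le_trans (ler_normD _ _)).
  have := hr x y ax xc' cy yb yr; lra.
have [cb'|] := ltP c b; last first.
  move=> bc; have [] // := Sy b.
  - by rewrite (le_lt_trans (lerB bc (lexx x))) //; lra.
have : S (Num.min b (c + (r - (c - x)) / 2)).
  apply: Sy.
  - by rewrite le_min cb /=; lra.
  - by rewrite ge_min lexx.
  - have : Num.min b (c + (r - (c - x)) / 2) <= c + (r - (c - x)) / 2.
      by rewrite ge_min lexx orbT.
    by lra.
move/(ub_le_sup Sub); rewrite -/c ge_min => /orP[|]; lra.
Qed.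


(** Leibniz rule. *)
Lemma has_slopeM (k : R -> R) (k' : R) g a b c l : a <= c -> c <= b ->
  has_slope k a b c k' -> has_slope g a b c l ->
  has_slope (fun t => k t *: g t) a b c (k c *: l + k' *: g c).
Proof.
move=> ac cb sk sg e e0.
pose M := `|k c| + 2 * (`|k'| + 1) + `|g c| + 1.
have M0 : 0 < M by rewrite ltr_wpDl // !addr_ge0 // mulr_ge0 // addr_ge0.
have eM : 0 < e / M by exact: divr_gt0.
have [r1 r10 h1] := sk _ eM; have [r2 r20 h2] := sg _ eM.
have [r3 r30 h3] := has_slope_continuous ac cb sg eM.
have [r4 r40 h4] := sk 1 ltr01.
exists (Num.min (Num.min r1 r2) (Num.min r3 r4)) => [|x y ax xc cy yb].
  by rewrite !lt_min r10 r20 r30.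
rewrite !lt_min => /andP[/andP[yr1 yr2] /andP[yr3 yr4]].
have xy : 0 <= y - x by rewrite subr_ge0 (le_trans xc).
have Lip z w : a <= z -> z <= c -> c <= w -> w <= b -> w - z < r4 ->
    `|k w - k z| <= (`|k'| + 1) * (w - z).
  move=> az zc cw wb wr.
  have wz : 0 <= w - z by rewrite subr_ge0 (le_trans zc).
  have := h4 z w az zc cw wb wr; rewrite [X in _ <= X]mul1r => H.
  have -> : k w - k z = (k w - k z - (w - z) *: k') + (w - z) *: k' by rewrite subrK.
  apply: (le_trans (ler_normD _ _)); rewrite normrZ (ger0_norm wz).
  by move: H; set X := `|_|; lra.
have ky : `|k y - k c| <= (`|k'| + 1) * (y - x).
  apply: (le_trans (Lip c y ac (lexx c) cy yb _)); first by lra.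
  by rewrite ler_wpM2l ?addr_ge0 //; lra.
have kx : `|k x - k c| <= (`|k'| + 1) * (y - x).
  rewrite distrC; apply: (le_trans (Lip x c ax xc (lexx c) cb _)); first by lra.
  by rewrite ler_wpM2l ?addr_ge0 //; lra.
have gy : `|g y - g c| <= e / M.
  by apply: h3 => //; [exact: le_trans cy|rewrite ger0_norm; lra].
have gx : `|g x - g c| <= e / M.
  by apply: h3 => //; [exact: le_trans cb|rewrite ler0_norm; lra].
have -> : k y *: g y - k x *: g x - (y - x) *: (k c *: l + k' *: g c) =
    k c *: (g y - g x - (y - x) *: l) + (k y - k c) *: (g y - g c)
    - (k x - k c) *: (g x - g c) + (k y - k x - (y - x) *: k') *: g c.
  rewrite scalerDr !scalerA [(y - x) * k c]mulrC -scalerA.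
  rewrite (_ : k y - k x - (y - x) *: k' = (k y - k c) - (k x - k c) - (y - x) * k');
    last by rewrite opprB addrA subrK.
  rewrite [(_ - (y - x) * k') *: _]scalerBl [(k y - k c - (k x - k c)) *: _]scalerBl.
  rewrite !scalerBr opprB.
  set A := k c *: _; set B := k c *: g x; set C := k c *: _; set D := _ *: g y; 
  set E := _ *: g c; set F := _ *: g c; set G := _ *: g x; set H := _ *: g c.
  rewrite opprD !addrA; congr (_ - _).
  - rewrite [(k y - k c) *: g y]scalerBl [(k x - k c) *: g x]scalerBl.
    rewrite -/A -/B -/D -/G.
    rewrite (addrAC _ (- (G - B)) F) (addrAC _ H F) subrK.
    rewrite (addrAC _ _ (- H)) addrK opprB [X in _ = X + _]addrC.
    have -> : D - A + (A - B - C) = D - B - C.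
      by rewrite -[A - B - C]addrA [LHS]addrA subrK addrA.
    by rewrite [in RHS](addrAC D) [RHS]addrA subrK -scalerA -/C addrAC.
  - by rewrite scalerA.
have -> : e * (y - x) = `|k c| * (e / M * (y - x)) +
    ((`|k'| + 1) * (y - x)) * (e / M) + ((`|k'| + 1) * (y - x)) * (e / M)
    + (e / M * (y - x)) * `|g c| + e / M * (y - x).
  have {1}-> : e = e / M * M by rewrite divfK // lt0r_neq0.
  by rewrite [in LHS]/M; move: (e / M) => q; ring.
apply: (le_trans (ler_normD _ _)); rewrite -[X in X <= _]addr0.
apply: lerD; last by rewrite mulr_ge0 // ltW.
apply: lerD; last first.
  by rewrite normrZ ler_wpM2r // h1.
apply: (le_trans (ler_normB _ _)); apply: lerD; last first.
  by rewrite normrZ ler_pM.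
apply: (le_trans (ler_normD _ _)); apply: lerD.
  by rewrite normrZ ler_wpM2l // h2.
by rewrite normrZ ler_pM.
Qed.

End slopes.

Lemma is_derive_has_slope {R : realType} (f : R -> R) (a b c l : R) :
  a <= c -> c <= b -> is_derive c 1 f l -> has_slope f a b c l.
Proof.
move=> ac cb [df dfl]; apply: has_slope_at => // e e0.
move: df; rewrite /derivable => /cvg_ex [l' hl].
have El : l' = l by rewrite -dfl /derive; apply/esym/cvg_lim.
rewrite El in hl.
move/cvgrPdist_le : hl => /(_ e e0).
rewrite near_withinE => /nbhs_ballP[r /= r0 hr].
exists r => // y ay yb yc.
have [->|ync] := eqVneq y c.
  by rewrite !subrr scale0r subrr normr0 mulr0.
have := hr (y - c); rewrite -ball_normE /= sub0r normrN => /(_ yc).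
rewrite subr_eq0 => /(_ ync).
rewrite /GRing.scale /= mulr1 subrK => H.
have ync' : y - c != 0 by rewrite subr_eq0.
have -> : f y - f c - (y - c) * l = (y - c) * ((y - c)^-1 * (f y - f c) - l).
  by field.
by rewrite normrM mulrC ler_wpM2r // distrC.
Qed.

(** If [g' = P - g] and [h' = m - h], a bound of [P] by [m + d] gives a bound of
    [g] by [h] in which the error [d] is multiplied by a factor less than [1].
    This gain is what makes the comparison argument below close. *)
Lemma damped_comparison {R : realType} {V : normedModType R} (g P : R -> V)
    (h m : R -> R) (a b d : R) : a <= b ->
  (forall c, a <= c -> c <= b -> has_slope g a b c (P c - g c)) ->
  (forall c, a <= c -> c <= b -> has_slope h a b c (m c - h c)) ->
  (forall c, a <= c -> c <= b -> `|P c| <= m c + d) ->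
  `|g a| <= h a ->
  `|g b| <= h b + d * (1 - expR (a - b)).
Proof.
move=> ab sg sh PM ga.
have se c : a <= c -> c <= b -> has_slope expR a b c (expR c).
  by move=> ac cb; apply: is_derive_has_slope.
(* Multiplying by the exponential turns [P - g] into [expR * P]. *)
have key : `|expR b *: g b - expR a *: g a| <=
    expR b * (h b + d) - expR a * (h a + d).
  apply: (@mean_value_inequality _ _ (fun t => expR t *: g t)
     (fun t => expR t * (h t + d))) => // c ac cb e e0.
  have s1 := has_slopeM ac cb (se c ac cb) (sg c ac cb).
  have sd := has_slopeD (sh c ac cb) (has_slope_cst d a b c).
  have s2 := has_slopeM ac cb (se c ac cb) sd.
  have e20 : 0 < e / 2 by rewrite divr_gt0.
  have [r1 r10 h1] := s1 _ e20; have [r2 r20 h2] := s2 _ e20.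
  exists (Num.min r1 r2) => [|x y ax xc cy yb]; first by rewrite lt_min r10.
  rewrite lt_min => /andP[yr1 yr2].
  have xy : 0 <= y - x by rewrite subr_ge0 (le_trans xc).
  have {}h1 := h1 x y ax xc cy yb yr1; have {}h2 := h2 x y ax xc cy yb yr2.
  rewrite -scalerDr subrK in h1; rewrite addr0 in h2.
  have H1 : `|expR y *: g y - expR x *: g x| <=
     e / 2 * (y - x) + (y - x) * (expR c * (m c + d)).
    rewrite -[X in `|X|](subrK ((y - x) *: (expR c *: P c))).
    apply: (le_trans (ler_normD _ _)); apply: lerD => //.
    rewrite !normrZ (ger0_norm xy) ler_wpM2l // ger0_norm ?expR_ge0 //.
    by rewrite ler_wpM2l ?expR_ge0 // PM.
  move: h2; rewrite /GRing.scale /= => /ler_normlP[h2 _].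
  have := h2; nra.
have : `|expR b *: g b| <= expR b * (h b + d) - expR a * d.
  rewrite -[X in `|X|](subrK (expR a *: g a)).
  apply: (le_trans (ler_normD _ _)).
  rewrite [X in _ + X]normrZ (ger0_norm (expR_ge0 a)).
  have := ler_wpM2l (expR_ge0 a) ga; lra.
rewrite normrZ (ger0_norm (expR_ge0 b)) => H.
rewrite -(ler_pM2l (expR_gt0 b)); apply: (le_trans H).
have <- : expR b * expR (a - b) = expR a by rewrite -expRD addrC subrK.
by rewrite le_eqVlt; apply/orP; left; apply/eqP; ring.
Qed.

(** * Bounded measurable functions *)

(** A function is [bounded_measurable] on [D] when it is measurable and bounded
    there; on a set of finite measure such functions are integrable, and they
    form an algebra. *)
Definition bounded_measurable {R : realType} (D : set R) (f : R -> R) : Prop :=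
  measurable_fun D f /\ exists M : R, forall x, D x -> `|f x| <= M.

Section bounded_measurable.
Context {R : realType}.
Notation mu := (@lebesgue_measure R).
Variable D : set R.
Hypothesis mD : measurable D.
Hypothesis Dfin : (mu D < +oo)%E.
Implicit Types f g h : R -> R.

Lemma bounded_measurable_cst k : bounded_measurable D (fun=> k).
Proof. by split; [exact: measurable_cst|exists `|k|]. Qed.

Lemma bounded_measurableD f g : bounded_measurable D f ->
  bounded_measurable D g -> bounded_measurable D (fun x => f x + g x).
Proof.
move=> [mf [M HM]] [mg [N HN]]; split; first exact: measurable_funD.
exists (M + N) => x Dx.
by rewrite (le_trans (ler_normD _ _)) // lerD ?HM ?HN.
Qed.

Lemma bounded_measurableM f g : bounded_measurable D f ->
  bounded_measurable D g -> bounded_measurable D (fun x => f x * g x).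
Proof.
move=> [mf [M HM]] [mg [N HN]]; split; first exact: measurable_funM.
by exists (M * N) => x Dx; rewrite normrM ler_pM ?HM ?HN.
Qed.

Lemma bounded_measurableB f g : bounded_measurable D f ->
  bounded_measurable D g -> bounded_measurable D (fun x => f x - g x).
Proof.
move=> mf mg; have := bounded_measurableD mf
  (bounded_measurableM (bounded_measurable_cst (-1)) mg).
by under eq_fun do rewrite mulN1r.
Qed.

Lemma bounded_measurable_integrable f : bounded_measurable D f ->
  mu.-integrable D (EFin \o f).
Proof.
move=> [mf [M HM]]; apply: measurable_bounded_integrable => //.
exists M; split; first exact: num_real.
by move=> N MN x Dx /=; rewrite (le_trans (HM x Dx)) // ltW.
Qed.

Lemma bounded_Rintegral f B : bounded_measurable D f ->
  (forall x, D x -> `|f x| <= B) ->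
  `|\int[mu]_(x in D) f x| <= B * fine (mu D).
Proof.
move=> bf fB.
apply: (le_trans (le_normr_Rintegral _ _)) => //.
  exact: bounded_measurable_integrable.
rewrite -Rintegral_cst //; apply: le_Rintegral => //.
  exact: integrable_norm (bounded_measurable_integrable bf).
exact: bounded_measurable_integrable (bounded_measurable_cst B).
Qed.

Lemma Rintegral_lin f g h k : bounded_measurable D f ->
  bounded_measurable D g -> bounded_measurable D h ->
  \int[mu]_(x in D) f x - \int[mu]_(x in D) g x - k * \int[mu]_(x in D) h x =
  \int[mu]_(x in D) (f x - g x - k * h x).
Proof.
move=> bf bg bh.
have bk := bounded_measurableM (bounded_measurable_cst k) bh.
have bfg := bounded_measurableB bf bg.
rewrite -RintegralZl //; last exact: bounded_measurable_integrable.
rewrite -RintegralB //; try exact: bounded_measurable_integrable.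
by rewrite -RintegralB //; exact: bounded_measurable_integrable.
Qed.

End bounded_measurable.

(** * A Taylor estimate for damped oscillations *)

Section oscillation.
Context {R : realType}.
Variables (a b k m n : R).

(* [E] below has derivative [E'] and second derivative [E'']. *)
Let E (z : R) : R := expR (- (m + a * z)) * sin (n + b * z) * k.
Let E' (z : R) : R :=
  expR (- (m + a * z)) * (b * k * cos (n + b * z) - a * k * sin (n + b * z)).
Let E'' (z : R) : R := expR (- (m + a * z)) *
  ((a ^+ 2 * k - b ^+ 2 * k) * sin (n + b * z) - 2 * (a * b * k) * cos (n + b * z)).

Let dE (z : R) : is_derive z 1 E (E' z).
Proof.
rewrite /E; apply: is_derive_eq.
rewrite /E' /GRing.scale /=; ring.
Qed.

Let dE' (z : R) : is_derive z 1 E' (E'' z).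
Proof.
rewrite /E'; apply: is_derive_eq.
rewrite /E'' /GRing.scale /=; ring.
Qed.

(** The constants in the hypotheses are those of the kernels below, for which
    the second derivative is at most 6 as long as the exponent is nonpositive. *)
Lemma oscillation_taylor : 0 <= a -> `|a * b * k| <= 1 -> `|a ^+ 2 * k| <= 2 ->
  `|b ^+ 2 * k| <= 2 -> forall x c y, x <= c -> c <= y -> 0 <= m + a * x ->
  `|E y - E x - (y - x) * E' c| <= 6 * (y - x) ^+ 2.
Proof.
move=> a0 ab1 a2 b2 x c y xc cy mx.
have xy := le_trans xc cy.
have cE : continuous E.
  by move=> z; apply/differentiable_continuous/derivable1_diffP; case: (dE z).
have cE' : continuous E'.
  by move=> z; apply/differentiable_continuous/derivable1_diffP; case: (dE' z).
have E''le z : x <= z -> `|E'' z| <= 6.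
  move=> xz; rewrite normrM ger0_norm ?expR_ge0 // -[6]mul1r ler_pM //.
  - by rewrite -expR0 ler_expR; nra.
  apply: (le_trans (ler_normB _ _)).
  rewrite !normrM (_ : 6 = 4 + 2); last by ring.
  apply: lerD.
    rewrite -[4]mulr1 ler_pM ?sin_max //.
    by rewrite (le_trans (ler_normB _ _)) // (_ : 4 = 2 + 2) ?lerD //; ring.
  rewrite -[X in _ <= X]mulr1 ler_pM ?cos_max // -!normrM normrM ger0_norm //.
  by rewrite -[X in _ <= X]mulr1 ler_wpM2l.
have [z zxy ->] := MVT_segment xy (fun z _ => dE z) (continuous_subspaceT cE).
move: zxy; rewrite in_itv /= => /andP[xz zy].
have key u v : x <= u -> u <= v -> v <= y -> `|E' v - E' u| <= 6 * (y - x).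
  move=> xu uv vy.
  have [w] := MVT_segment uv (fun z _ => dE' z) (continuous_subspaceT cE').
  rewrite in_itv /= => /andP[uw wv] ->.
  rewrite normrM (ger0_norm (_ : 0 <= v - u)) ?subr_ge0 // ler_pM ?subr_ge0 //.
    by apply: E''le; lra.
  by lra.
rewrite mulrC -mulrBr normrM ger0_norm ?subr_ge0 // expr2 mulrCA.
rewrite ler_wpM2l ?subr_ge0 //.
have [zc|/ltW cz] := leP z c; last exact: key.
by rewrite distrC; exact: key.
Qed.

End oscillation.

(** * The kernels *)

Lemma expR_lipschitz {R : realType} (u v : R) : 0 <= u -> 0 <= v ->
  `|expR (- u) - expR (- v)| <= `|u - v|.
Proof.
wlog uv : u v / u <= v => [hw u0 v0|u0 v0].
  have [uv|/ltW vu] := leP u v; first exact: hw.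
  by rewrite distrC (distrC u); apply: hw.
have eu : expR (- u) <= 1 by rewrite -expR0 ler_expR oppr_le0.
have vu1 : 1 - expR (u - v) <= v - u.
  have := expR_ge1Dx (u - v); lra.
have vu0 : 0 <= 1 - expR (u - v) by rewrite subr_ge0 -expR0 ler_expR subr_le0.
have -> : expR (- u) - expR (- v) = expR (- u) * (1 - expR (u - v)).
  by rewrite mulrBr mulr1 -expRD addrA addNr add0r.
rewrite normrM (distrC u) (ger0_norm vu0) !ger0_norm ?expR_ge0 ?subr_ge0 //.
by rewrite -[X in _ <= X]mul1r ler_pM // expR_ge0.
Qed.

Lemma sin_le_norm {R : realType} (x : R) : `|sin x| <= `|x|.
Proof.
wlog x0 : x / 0 <= x => [hw|].
  have [x0|/ltW x0] := leP 0 x; first exact: hw.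
  by rewrite -normrN -sinN -[X in _ <= X]normrN; apply: hw; rewrite oppr_ge0.
have [z _] := MVT_segment x0 (fun z _ => is_derive_sin z)
  (continuous_subspaceT (@continuous_sin R)).
by rewrite sin0 !subr0 => ->; rewrite normrM ler_piMl // cos_max.
Qed.

Section kernels.
Context {R : realType}.
Notation mu := (@lebesgue_measure R).
Let D : set R := `]0, pi[%classic.
Implicit Types (s t x c y th : R).

(** The kernels are superpositions, over an angle [th] in ]0, pi[, of the
    exponential solutions of the equation d_s d_t F + d_s F + d_t F = 0.
    Probabilistically, if N and N' are independent Poisson variables of means
    [t] and [s], then

      [Fker s t] = P(N > N') - P(N < N'),
      [Wker s t] = P(N = N') + P(N = N' - 1),

    and [Gker = Fker + Wker].  They are related by d_t F = W and d_s G = - W.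
    The integral formulas are those given by Fourier inversion; they are taken
    as definitions, and the Poisson variables are not used. *)

(** [cothalf th] is cot (th / 2), for [th] in ]0, pi[. *)
Definition cothalf th : R := sin th / (1 - cos th).

Definition kerF s t th : R :=
  expR (- ((1 - cos th) * (s + t))) * sin ((t - s) * sin th) * cothalf th.

Definition kerW s t th : R := expR (- ((1 - cos th) * (s + t))) *
  (cos ((t - s) * sin th) + cos ((t - s) * sin th + th)).

Definition kerG s t th : R :=
  expR (- ((1 - cos th) * (s + t))) * sin ((t - s) * sin th + th) * cothalf th.

(** The derivative of [kerG 0 t] with respect to [t]. *)
Definition kerZ t th : R := expR (- ((1 - cos th) * t)) *
  (cos (t * sin th + th) + cos (t * sin th + th *+ 2)).

Definition Fker s t : R := pi^-1 * \int[mu]_(th in D) kerF s t th.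
Definition Wker s t : R := pi^-1 * \int[mu]_(th in D) kerW s t th.
Definition Gker s t : R := pi^-1 * \int[mu]_(th in D) kerG s t th.

Lemma measurable_oo_pi : measurable D.
Proof. exact: measurable_itv. Qed.

Lemma lebesgue_oo_pi : mu D = (pi)%:E.
Proof. by rewrite lebesgue_measure_itv /= lte_fin pi_gt0 oppr0 adde0. Qed.

Lemma lebesgue_oo_pi_fin : (mu D < +oo)%E.
Proof. by rewrite lebesgue_oo_pi ltry. Qed.

Lemma cos_lt1 th : D th -> cos th < 1.
Proof.
rewrite /D /= in_itv /= => /andP[th0 thpi].
have := @ltr_cos R 0 th; rewrite !in_itv /= lexx pi_ge0 (ltW th0) (ltW thpi).
by move=> /(_ isT isT); rewrite cos0 th0 => ->.
Qed.

Lemma mulr_cos_cothalf th : D th -> (1 - cos th) * cothalf th = sin th.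
Proof.
move=> /cos_lt1 c1; rewrite /cothalf mulrC divfK //.
by rewrite gt_eqF // subr_gt0.
Qed.

Lemma mulr_sin_cothalf th : D th -> sin th * cothalf th = 1 + cos th.
Proof.
move=> /cos_lt1 c1; rewrite /cothalf mulrA -expr2 sin2cos2.
have -> : 1 - cos th ^+ 2 = (1 + cos th) * (1 - cos th) by ring.
by rewrite mulfK // gt_eqF // subr_gt0.
Qed.

Lemma measurable_sinD (f : R -> R) : measurable_fun D f ->
  measurable_fun D (fun th => sin (f th)).
Proof.
move=> mf; apply: (measurableT_comp _ mf).
by apply: continuous_measurable_fun; exact: continuous_sin.
Qed.

Lemma measurable_cosD (f : R -> R) : measurable_fun D f ->
  measurable_fun D (fun th => cos (f th)).
Proof.
move=> mf; apply: (measurableT_comp _ mf).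
by apply: continuous_measurable_fun; exact: continuous_cos.
Qed.

Lemma measurable_cothalf : measurable_fun D cothalf.
Proof.
apply: open_continuous_measurable_fun; first exact: interval_open.
move=> th; rewrite inE => Do.
apply: cvgM; first exact: continuous_sin.
apply: cvgV; first by rewrite subr_eq0 gt_eqF // cos_lt1.
by apply: cvgB; [exact: cvg_cst|exact: continuous_cos].
Qed.

Lemma measurable_expR_D (f : R -> R) : measurable_fun D f ->
  measurable_fun D (fun th => expR (f th)).
Proof. by move=> mf; apply: (measurableT_comp _ mf). Qed.

Lemma expR_cos_le s t th : expR (- ((1 - cos th) * (s + t))) <= expR (2 * `|s + t|).
Proof.
rewrite ler_expR; have := cos_le1 th; have := cos_geN1 th.
have := ler_norm (s + t); have := ler_norm (- (s + t)); rewrite normrN; nra.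
Qed.

Lemma expR_cos_le1 p th : 0 <= p -> expR (- ((1 - cos th) * p)) <= 1.
Proof.
by move=> p0; rewrite -expR0 ler_expR oppr_le0 mulr_ge0 // subr_ge0 cos_le1.
Qed.

Lemma bounded_measurable_kerW s t : bounded_measurable D (kerW s t).
Proof.
split; last first.
  exists (expR (2 * `|s + t|) * 2) => th Do.
  rewrite normrM; apply: ler_pM => //.
    by rewrite ger0_norm ?expR_ge0 ?expR_cos_le.
  by rewrite (le_trans (ler_normD _ _)) // (_ : 2 = 1 + 1) ?lerD ?cos_max.
apply: measurable_funM.
  apply: measurable_expR_D; apply: measurable_funN; apply: measurable_funM => //.
  by apply: measurable_funB => //; exact: measurable_cosD.
have m1 : measurable_fun D (fun th => (t - s) * sin th).
  by apply: measurable_funM => //; exact: measurable_sinD.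
apply: measurable_funD; apply: measurable_cosD => //.
exact: measurable_funD.
Qed.

Lemma bounded_measurable_kerZ t : bounded_measurable D (kerZ t).
Proof.
split; last first.
  exists (expR (2 * `|0 + t|) * 2) => th Do.
  rewrite normrM; apply: ler_pM => //.
    by rewrite ger0_norm ?expR_ge0 // -[X in _ * X]add0r expR_cos_le.
  by rewrite (le_trans (ler_normD _ _)) // (_ : 2 = 1 + 1) ?lerD ?cos_max.
apply: measurable_funM.
  apply: measurable_expR_D; apply: measurable_funN; apply: measurable_funM => //.
  by apply: measurable_funB => //; exact: measurable_cosD.
have m1 : measurable_fun D (fun th => t * sin th).
  by apply: measurable_funM => //; exact: measurable_sinD.
apply: measurable_funD; apply: measurable_cosD => //.
  exact: measurable_funD.
by apply: measurable_funD => //; exact: measurable_funD.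
Qed.

(** The singularity of [cothalf] at [0] is cancelled by [sin]. *)
Lemma sin_cothalf_le s t th : D th ->
  `|sin ((t - s) * sin th) * cothalf th| <= 2 * `|t - s|.
Proof.
move=> Do; rewrite normrM.
apply: (@le_trans _ _ (`|(t - s) * sin th| * `|cothalf th|)).
  by rewrite ler_wpM2r // sin_le_norm.
rewrite -normrM -mulrA mulr_sin_cothalf // normrM mulrC ler_wpM2r //.
by rewrite (le_trans (ler_normD _ _)) // normr1 (_ : 2 = 1 + 1) ?lerD ?cos_max.
Qed.

Lemma bounded_measurable_kerF s t : bounded_measurable D (kerF s t).
Proof.
split; last first.
  exists (expR (2 * `|s + t|) * (2 * `|t - s|)) => th Do.
  rewrite /kerF -mulrA normrM; apply: ler_pM; rewrite ?sin_cothalf_le //.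
  by rewrite ger0_norm ?expR_ge0 ?expR_cos_le.
apply: measurable_funM; last exact: measurable_cothalf.
apply: measurable_funM.
  apply: measurable_expR_D; apply: measurable_funN; apply: measurable_funM => //.
  by apply: measurable_funB => //; exact: measurable_cosD.
apply: measurable_sinD.
by apply: measurable_funM => //; exact: measurable_sinD.
Qed.

Lemma kerGE s t th : D th -> kerG s t th = kerF s t th + kerW s t th.
Proof.
move=> Do; rewrite /kerG /kerF /kerW sinD cosD.
set e := expR _; set S := sin (_ * _); set C := cos (_ * _).
have -> : e * (S * cos th + C * sin th) * cothalf th =
  e * (S * (cothalf th - (1 - cos th) * cothalf th) + C * (sin th * cothalf th)).
  by ring.
by rewrite mulr_cos_cothalf // mulr_sin_cothalf //; ring.
Qed.

Lemma GkerE s t : Gker s t = Fker s t + Wker s t.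
Proof.
rewrite /Gker /Fker /Wker -mulrDr -RintegralD.
- by congr (_ * _); apply: eq_Rintegral => th; rewrite inE => /kerGE.
- exact: measurable_oo_pi.
- exact: (bounded_measurable_integrable measurable_oo_pi lebesgue_oo_pi_fin
    (bounded_measurable_kerF s t)).
- exact: (bounded_measurable_integrable measurable_oo_pi lebesgue_oo_pi_fin
    (bounded_measurable_kerW s t)).
Qed.

End kernels.

(** * Derivatives of the kernels *)

Section kernel_calculus.
Context {R : realType}.
Notation mu := (@lebesgue_measure R).
Let D : set R := `]0, pi[%classic.
Implicit Types (s t x c y th : R).

Lemma le_average_oo_pi1 (f : R -> R) (B : R) : bounded_measurable D f ->
  (forall th, D th -> `|f th| <= B) -> `|pi^-1 * \int[mu]_(th in D) f th| <= B.
Proof.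
move=> bf HB.
have H := bounded_Rintegral (@measurable_oo_pi R) (@lebesgue_oo_pi_fin R) bf HB.
rewrite lebesgue_oo_pi /= in H.
rewrite normrM ger0_norm ?invr_ge0 ?pi_ge0 //.
by rewrite mulrC ler_pdivrMr // pi_gt0.
Qed.

(** Pointwise expansions of the integrands pass to the averages over ]0, pi[. *)
Lemma le_average_oo_pi (f g h : R -> R) (k B : R) : bounded_measurable D f ->
  bounded_measurable D g -> bounded_measurable D h ->
  (forall th, D th -> `|f th - g th - k * h th| <= B) ->
  `|pi^-1 * \int[mu]_(th in D) f th - pi^-1 * \int[mu]_(th in D) g th
    - k * (pi^-1 * \int[mu]_(th in D) h th)| <= B.
Proof.
move=> bf bg bh HB.
have mD := @measurable_oo_pi R; have Dfin := @lebesgue_oo_pi_fin R.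
rewrite mulrCA -!mulrBr (Rintegral_lin mD Dfin) //.
have bfg := bounded_measurableB bf bg.
have bk := bounded_measurableM (bounded_measurable_cst _ k) bh.
by apply: le_average_oo_pi1 => //; exact: bounded_measurableB.
Qed.

Lemma le_average_oo_piB (f g : R -> R) (B : R) : bounded_measurable D f ->
  bounded_measurable D g -> (forall th, D th -> `|f th - g th| <= B) ->
  `|pi^-1 * \int[mu]_(th in D) f th - pi^-1 * \int[mu]_(th in D) g th| <= B.
Proof.
move=> bf bg HB.
have mD := @measurable_oo_pi R; have Dfin := @lebesgue_oo_pi_fin R.
rewrite -mulrBr -RintegralB //; try exact: bounded_measurable_integrable.
by apply: le_average_oo_pi1 => //; exact: bounded_measurableB.
Qed.

(* The three coefficients that appear in the Taylor estimate, with damping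
   [1 - cos th], frequency [sin th] and amplitude [cothalf th]. *)
Let coef1 th : D th -> `|(1 - cos th) * sin th * cothalf th| <= 1.
Proof.
move=> Dth; rewrite mulrAC mulr_cos_cothalf // normrM.
by rewrite -[X in _ <= X]mul1r ler_pM // sin_max.
Qed.

Let coef2 th : D th -> `|(1 - cos th) ^+ 2 * cothalf th| <= 2.
Proof.
move=> Dth; rewrite expr2 -mulrA mulr_cos_cothalf // normrM.
rewrite -[X in _ <= X]mulr1 ler_pM ?sin_max //.
by rewrite (le_trans (ler_normB _ _)) // normr1 (_ : 2 = 1 + 1) ?lerD ?cos_max.
Qed.

Let coef3 th : D th -> `|sin th ^+ 2 * cothalf th| <= 2.
Proof.
move=> Dth; rewrite expr2 -mulrA mulr_sin_cothalf // normrM mulrC.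
rewrite -[X in _ <= X]mulr1 ler_pM ?sin_max //.
by rewrite (le_trans (ler_normD _ _)) // normr1 (_ : 2 = 1 + 1) ?lerD ?cos_max.
Qed.

Let cos0 th : 0 <= 1 - cos th.
Proof. by rewrite subr_ge0 cos_le1. Qed.

(** d_t F = W, with a uniform quadratic remainder. *)
Lemma Fker_taylor s x c y : x <= c -> c <= y -> 0 <= s + x ->
  `|Fker s y - Fker s x - (y - x) * Wker s c| <= 6 * (y - x) ^+ 2.
Proof.
move=> xc cy sx; apply: le_average_oo_pi.
- exact: bounded_measurable_kerF.
- exact: bounded_measurable_kerF.
- exact: bounded_measurable_kerW.
move=> th Dth.
have FE z : kerF s z th =
    expR (- ((1 - cos th) * s + (1 - cos th) * z)) *
    sin (- (s * sin th) + sin th * z) * cothalf th.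
  by rewrite /kerF mulrDr; congr (_ * sin _ * _); ring.
have WE z : kerW s z th =
    expR (- ((1 - cos th) * s + (1 - cos th) * z)) *
    (sin th * cothalf th * cos (- (s * sin th) + sin th * z) -
     (1 - cos th) * cothalf th * sin (- (s * sin th) + sin th * z)).
  rewrite mulr_sin_cothalf // mulr_cos_cothalf // /kerW [(1 - cos th) * (_ + _)]mulrDr.
  have -> : (z - s) * sin th = - (s * sin th) + sin th * z by ring.
  by congr (_ * _); rewrite [cos (_ + th)]cosD; ring.
rewrite !FE WE; apply: oscillation_taylor => //.
- exact: coef1.
- exact: coef2.
- exact: coef3.
- by rewrite -mulrDr mulr_ge0.
Qed.

(** d_s G = - W, with a uniform quadratic remainder. *)
Lemma Gker_taylor t x c y : x <= c -> c <= y -> 0 <= x + t ->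
  `|Gker y t - Gker x t + (y - x) * Wker c t| <= 6 * (y - x) ^+ 2.
Proof.
move=> xc cy xt.
have -> : (y - x) * Wker c t = - (- (y - x) * Wker c t) by rewrite mulNr opprK.
have bG z : bounded_measurable D (kerG z t).
  have := bounded_measurableD (bounded_measurable_kerF z t)
    (bounded_measurable_kerW z t).
  move=> [m [M HM]]; split.
    by apply: eq_measurable_fun m => th; rewrite inE => Dth /=; rewrite kerGE.
  by exists M => th Dth; rewrite kerGE // HM.
apply: le_average_oo_pi => //.
- exact: bounded_measurable_kerW.
move=> th Dth.
have GE z : kerG z t th =
    expR (- ((1 - cos th) * t + (1 - cos th) * z)) *
    sin ((t * sin th + th) + - sin th * z) * cothalf th.
  rewrite /kerG (addrC z) mulrDr; congr (_ * sin _ * _); ring.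
have WE z : - kerW z t th =
    expR (- ((1 - cos th) * t + (1 - cos th) * z)) *
    (- sin th * cothalf th * cos ((t * sin th + th) + - sin th * z) -
     (1 - cos th) * cothalf th * sin ((t * sin th + th) + - sin th * z)).
  rewrite mulNr mulr_sin_cothalf // mulr_cos_cothalf // /kerW (addrC z).
  rewrite [(1 - cos th) * (_ + _)]mulrDr.
  have -> : (t - z) * sin th = (t * sin th + th) + - sin th * z - th by ring.
  rewrite -mulrN subrK; congr (_ * _); rewrite [cos (_ - th)]cosB; ring.
have -> : - (y - x) * kerW c t th = (y - x) * - kerW c t th by rewrite mulrN mulNr.
rewrite !GE WE; apply: oscillation_taylor => //.
- by rewrite mulrN mulNr normrN coef1.
- exact: coef2.
- by rewrite sqrrN coef3.
- by rewrite -mulrDr addrC mulr_ge0 // addrC.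
Qed.

Lemma Gker0_taylor x c y : x <= c -> c <= y -> 0 <= x ->
  `|Gker 0 y - Gker 0 x - (y - x) * (pi^-1 * \int[mu]_(th in D) kerZ c th)|
    <= 6 * (y - x) ^+ 2.
Proof.
move=> xc cy xt.
have bG z : bounded_measurable D (kerG 0 z).
  have := bounded_measurableD (bounded_measurable_kerF 0 z)
    (bounded_measurable_kerW 0 z).
  move=> [m [M HM]]; split.
    by apply: eq_measurable_fun m => th; rewrite inE => Dth /=; rewrite kerGE.
  by exists M => th Dth; rewrite kerGE // HM.
apply: le_average_oo_pi => //.
- exact: bounded_measurable_kerZ.
move=> th Dth.
have GE z : kerG 0 z th =
    expR (- (0 + (1 - cos th) * z)) * sin (th + sin th * z) * cothalf th.
  rewrite /kerG !add0r subr0; congr (_ * sin _ * _); ring.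
have ZE z : kerZ z th =
    expR (- (0 + (1 - cos th) * z)) *
    (sin th * cothalf th * cos (th + sin th * z) -
     (1 - cos th) * cothalf th * sin (th + sin th * z)).
  rewrite mulr_sin_cothalf // mulr_cos_cothalf // /kerZ add0r.
  have -> : z * sin th + th *+ 2 = (th + sin th * z) + th by ring.
  have -> : z * sin th + th = th + sin th * z by ring.
  congr (_ * _); rewrite [cos (_ + th)]cosD; ring.
rewrite !GE ZE; apply: oscillation_taylor => //.
- exact: coef1.
- exact: coef2.
- exact: coef3.
- by rewrite add0r mulr_ge0.
Qed.

(** When [t - s] is fixed, the kernels are Lipschitz functions of [s + t].  This
    is only used for the measurability of the integrands of the convolutions. *)
Lemma Fker_lipschitz s t s' t' : t' - s' = t - s -> 0 <= s + t -> 0 <= s' + t' ->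
  `|Fker s t - Fker s' t'| <= `|(s + t) - (s' + t')|.
Proof.
move=> ts st st'.
apply: le_average_oo_piB.
- exact: bounded_measurable_kerF.
- exact: bounded_measurable_kerF.
move=> th Dth; rewrite /kerF ts -!mulrA -mulrBl normrM.
set A := sin _ * _.
apply: (@le_trans _ _ (`|(1 - cos th) * (s + t) - (1 - cos th) * (s' + t')| * `|A|)).
  by rewrite ler_wpM2r // expR_lipschitz // mulr_ge0.
rewrite -mulrBr -normrM mulrAC normrM mulrC -[X in _ <= X]mulr1 ler_wpM2l //.
rewrite /A mulrCA mulr_cos_cothalf // normrM.
by rewrite -[X in _ <= X]mul1r ler_pM // sin_max.
Qed.

Lemma Wker_lipschitz s t s' t' : t' - s' = t - s -> 0 <= s + t -> 0 <= s' + t' ->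
  `|Wker s t - Wker s' t'| <= 4 * `|(s + t) - (s' + t')|.
Proof.
move=> ts st st'.
apply: le_average_oo_piB.
- exact: bounded_measurable_kerW.
- exact: bounded_measurable_kerW.
move=> th Dth; rewrite /kerW ts -mulrBl normrM.
set A := cos _ + _.
apply: (@le_trans _ _ (`|(1 - cos th) * (s + t) - (1 - cos th) * (s' + t')| * `|A|)).
  by rewrite ler_wpM2r // expR_lipschitz // mulr_ge0.
rewrite -mulrBr normrM mulrAC ler_wpM2r //.
rewrite (_ : 4 = 2 * 2); last by ring.
apply: ler_pM => //.
  by rewrite (le_trans (ler_normB _ _)) // normr1 (_ : 2 = 1 + 1) ?lerD ?cos_max.
by rewrite (le_trans (ler_normD _ _)) // (_ : 2 = 1 + 1) ?lerD ?cos_max.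
Qed.

Lemma Fker_le s t : 0 <= s + t -> `|Fker s t| <= 2 * `|t - s|.
Proof.
move=> st; apply: le_average_oo_pi1; first exact: bounded_measurable_kerF.
move=> th Dth; rewrite /kerF -mulrA normrM.
rewrite -[X in _ <= X]mul1r ler_pM ?sin_cothalf_le //.
by rewrite ger0_norm ?expR_ge0 ?expR_cos_le1.
Qed.

Lemma Wker_le s t : 0 <= s + t -> `|Wker s t| <= 2.
Proof.
move=> st; apply: le_average_oo_pi1; first exact: bounded_measurable_kerW.
move=> th Dth; rewrite /kerW normrM.
rewrite -[X in _ <= X]mul1r ler_pM //.
  by rewrite ger0_norm ?expR_ge0 ?expR_cos_le1.
by rewrite (le_trans (ler_normD _ _)) // (_ : 2 = 1 + 1) ?lerD ?cos_max.
Qed.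

Lemma Fker_diag s : Fker s s = 0.
Proof.
rewrite /Fker (@eq_Rintegral _ _ _ _ _ (fun=> 0)).
  by rewrite Rintegral_cst ?mul0r ?mulr0 //; exact: measurable_oo_pi.
by move=> th _; rewrite /kerF subrr mul0r sin0 mulr0 mul0r.
Qed.

End kernel_calculus.

(** * Integrals of continuous functions *)

Section continuous_functions.
Context {R : realType}.

Lemma continuous_fun_comp (f g : R -> R) : continuous f -> continuous g ->
  continuous (fun x => g (f x)).
Proof. by move=> cf cg x; exact: (continuous_comp (cf x) (cg (f x))). Qed.

Lemma continuous_funD (f g : R -> R) : continuous f -> continuous g ->
  continuous (fun x => f x + g x).
Proof. by move=> cf cg x; exact: (continuousD (cf x) (cg x)). Qed.

Lemma continuous_funM (f g : R -> R) : continuous f -> continuous g ->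
  continuous (fun x => f x * g x).
Proof. by move=> cf cg x; exact: (continuousM (cf x) (cg x)). Qed.

Lemma continuous_funN (f : R -> R) : continuous f -> continuous (fun x => - f x).
Proof. by move=> cf x; exact: (continuousN (cf x)). Qed.

Lemma continuous_fun_cst (k : R) : continuous (fun _ : R => k).
Proof. by move=> x; exact: cvg_cst. Qed.

Lemma continuous_fun_id : continuous (fun x : R => x).
Proof. by move=> x; exact: cvg_id. Qed.

End continuous_functions.

Section continuous_integrals.
Context {R : realType}.
Notation mu := (@lebesgue_measure R).
Implicit Types (f : R -> R) (a b x y : R).

Lemma continuous_itv_integrable f a b : continuous f ->
  mu.-integrable `[a, b] (EFin \o f).
Proof.
move=> cf; apply: continuous_compact_integrable; first exact: segment_compact.
exact: continuous_subspaceT.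
Qed.

Lemma is_derive_primitive f a x : continuous f -> a < x ->
  is_derive x 1 (fun z => \int[mu]_(r in `[a, z]) f r) (f x).
Proof.
move=> cf ax.
have [] := @continuous_FTC1_closed R f a x (x + 1) _ _ ax (cf x).
- by rewrite ltrDl.
- exact: continuous_itv_integrable.
move=> dF Ed; apply: DeriveDef; first exact: dF.
by rewrite -[LHS]derive1E; exact: Ed.
Qed.

Lemma Rintegral_segmentB f a x y : continuous f -> a <= x -> x <= y ->
  \int[mu]_(r in `[a, y]) f r - \int[mu]_(r in `[a, x]) f r =
  \int[mu]_(r in `[x, y]) f r.
Proof.
move=> cf ax xy.
rewrite Rintegral_itvB ?bnd_simp //; last exact: continuous_itv_integrable.
rewrite Rintegral_itv_obnd_cbnd //.
apply: integrableS (continuous_itv_integrable x y cf) => //.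
exact: subset_itv_oc_cc.
Qed.

Lemma Rintegral_FTC f (H : R -> R) a b : a < b -> continuous f ->
  (forall x, a <= x -> x <= b -> is_derive x 1 H (f x)) ->
  \int[mu]_(x in `[a, b]) f x = H b - H a.
Proof.
move=> ab cf dH.
have cH x : a <= x -> x <= b -> {for x, continuous H}.
  move=> ax xb; have [dHx _] := dH x ax xb.
  exact/differentiable_continuous/derivable1_diffP.
rewrite /Rintegral (@continuous_FTC2 _ f H) //.
- exact: continuous_subspaceT.
- split.
  + by move=> x; rewrite in_itv /= => /andP[ax xb]; case: (dH x (ltW ax) (ltW xb)).
  + by apply: cvg_at_right_filter; apply: cH => //; exact: ltW.
  + by apply: cvg_at_left_filter; apply: cH => //; exact: ltW.
- move=> x; rewrite in_itv /= => /andP[ax xb]; rewrite derive1E.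
  by case: (dH x (ltW ax) (ltW xb)).
Qed.

Lemma integral0_gauss_le x : \int[mu]_(r in `[0, x]) gauss_fun r <= Num.sqrt pi / 2.
Proof.
rewrite -lee_fin -integral0y_gauss /Rintegral fineK; last first.
  apply: integrable_fin_num => //.
  exact: continuous_itv_integrable continuous_gauss_fun.
apply: ge0_subset_integral => //=.
- apply/measurable_EFinP; apply: measurable_funTS; exact: measurable_gauss_fun.
- by move=> r _; rewrite lee_fin gauss_fun_ge0.
- by move=> r /=; rewrite !in_itv /= => /andP[-> _].
Qed.

End continuous_integrals.

(** * Special values of the kernels *)

Section kernel_values.
Context {R : realType}.
Notation mu := (@lebesgue_measure R).
Let D : set R := `]0, pi[%classic.
Implicit Types (s t x c y th : R).

Lemma Rintegral_oo_pi_FTC (f H : R -> R) : continuous f ->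
  (forall x, 0 <= x -> x <= pi -> is_derive x 1 H (f x)) ->
  \int[mu]_(x in D) f x = H pi - H 0.
Proof.
move=> cf dH; rewrite -(Rintegral_FTC (@pi_gt0 R) cf dH).
rewrite -Rintegral_itv_obnd_cbnd; last first.
  apply: integrableS (continuous_itv_integrable 0 pi cf) => //.
  exact: subset_itv_oc_cc.
rewrite Rintegral_itv_bndo_bndc //.
apply: integrableS (continuous_itv_integrable 0 pi cf) => //.
exact: subset_itv_oo_cc.
Qed.

(* Both are picked up as assumptions when terms are proved continuous. *)
Let cid := @continuous_fun_id R.
Let ccst := @continuous_fun_cst R.

Let kerZE t th : kerZ t th = expR (- t) * (expR (t * cos th) *
  (cos (t * sin th + th) + cos (t * sin th + th *+ 2))).
Proof. by rewrite /kerZ mulrA -expRD; congr (expR _ * _); ring. Qed.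

(** The integral of Re ((z + z^2) e^(t z)) over the half circle z = e^(i th)
    vanishes, because the integrand has an explicit primitive. *)
Lemma Rintegral_kerZ t : 0 <= t -> \int[mu]_(th in D) kerZ t th = 0.
Proof.
move=> t0.
have cs : continuous (@sin R) := @continuous_sin R.
have cc : continuous (@cos R) := @continuous_cos R.
have cZ : continuous (kerZ t).
  have ct : continuous (fun th => t * sin th) by exact: continuous_funM.
  apply: continuous_funM; last first.
    apply: continuous_funD; apply: (@continuous_fun_comp R _ cos) => //.
      exact: continuous_funD.
    by apply: continuous_funD => //; exact: continuous_funD.
  apply: (@continuous_fun_comp R _ expR); last exact: continuous_expR.
  apply: continuous_funN.
  by apply: continuous_funM => //; apply: continuous_funD => //; exact: continuous_funN.
have [t00|tn0] := eqVneq t 0.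
  have dH (x : R) : 0 <= x -> x <= pi ->
      is_derive x 1 (fun th => sin th + sin (th *+ 2) / 2) (kerZ t x).
    move=> _ _; apply: is_derive_eq; rewrite /GRing.scale /= /kerZ t00.
    rewrite !mulr0 oppr0 expR0 !mul0r !add0r. by field.
  rewrite (Rintegral_oo_pi_FTC cZ dH).
  by rewrite sinpi sin2pi mul0rn sin0 mul0r !addr0 subrr.
(* Both sin (t * sin th) and sin (t * sin th + th) vanish at 0 and pi. *)
pose H th := expR (- t) * (expR (t * cos th) *
   (t^-1 * sin (t * sin th + th) + (1 - t^-1) * t^-1 * sin (t * sin th))).
have dH (x : R) : 0 <= x -> x <= pi -> is_derive x 1 H (kerZ t x).
  move=> _ _; rewrite /H; apply: is_derive_eq; rewrite /GRing.scale /= kerZE.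
  have -> : t * sin x + x *+ 2 = (t * sin x + x) + x by ring.
  rewrite [cos (_ + x + x)]cosD !sinD !cosD.
  set S := sin (t * sin x); set C := cos (t * sin x); set s := sin x; set c := cos x.
  by field.
rewrite (Rintegral_oo_pi_FTC cZ dH).
by rewrite /H sinpi sin0 !mulr0 !add0r sinpi sin0 !mulr0 !addr0 !mulr0 subrr.
Qed.

Let continuous_add1cos : continuous (fun th : R => 1 + cos th).
Proof. by apply: continuous_funD => //; exact: continuous_cos. Qed.

Let is_derive_add_sin (x : R) : is_derive x 1 (fun th => th + sin th) (1 + cos x).
Proof. by apply: is_derive_eq. Qed.

Let Rintegral_add1cos : \int[mu]_(th in D) (1 + cos th) = pi.
Proof.
transitivity ((pi + sin pi) - (0 + sin 0) : R).
  exact: (Rintegral_oo_pi_FTC continuous_add1cos (fun x _ _ => is_derive_add_sin x)).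
by rewrite sinpi sin0 !addr0 subr0.
Qed.

Lemma Gker00 : Gker 0 0 = 1 :> R.
Proof.
have pi0 : pi != 0 :> R by rewrite gt_eqF // pi_gt0.
rewrite /Gker; have -> :
  \int[mu]_(th in D) kerG 0 0 th = \int[mu]_(th in D) (1 + cos th).
  apply: eq_Rintegral => th; rewrite inE => Dth.
  by rewrite /kerG add0r subrr mul0r mulr0 oppr0 expR0 mul1r add0r mulr_sin_cothalf.
by rewrite Rintegral_add1cos mulVf.
Qed.

(** On the boundary [s = 0] the kernel G is constant. *)
Lemma Gker0 t : 0 <= t -> Gker 0 t = 1.
Proof.
move=> t0; rewrite -Gker00; apply/eqP; rewrite -subr_eq0 -normr_le0.
rewrite -[X in _ <= X](subrr (0 : R)).
apply: (@mean_value_inequality _ R (Gker 0) (fun=> 0)) => // c c0 ct e e0.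
have s : has_slope (Gker 0) 0 t c (0 : R).
  apply: (@has_slope_quadratic _ R 6) => x y x0 xc cy yt.
  rewrite scaler0; have := Gker0_taylor xc cy x0.
  by rewrite Rintegral_kerZ ?mulr0.
have [r r0 hr] := s e e0; exists r => // x y x0 xc cy yt yr.
by have := hr x y x0 xc cy yt yr; rewrite scaler0 !subr0 add0r.
Qed.

(** The sharp constant comes from the Gaussian integral.  With x = sin (th / 2),
    the integral defining [Wker t t] is the integral of
    4 exp (- 4 t x^2) sqrt (1 - x^2) over [0, 1]; the square root is bounded by 1,
    and the remaining integral is at most that of exp (- 4 t x^2) over the
    half-line. *)
Lemma Wker_diag_le_sigma t : 0 <= t -> Wker t t <= sigma t.
Proof.
move=> t0.
have pi0 : pi != 0 :> R by rewrite gt_eqF // pi_gt0.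
have mD := @measurable_oo_pi R; have Dfin := @lebesgue_oo_pi_fin R.
have WE th : kerW t t th = expR (- ((1 - cos th) * (t + t))) * (1 + cos th).
  by rewrite /kerW subrr mul0r cos0 add0r.
have iW := bounded_measurable_integrable mD Dfin (bounded_measurable_kerW t t).
have le1 : Wker t t <= 1.
  rewrite /Wker mulrC ler_pdivrMr ?pi_gt0 // mul1r.
  apply: (@le_trans _ _ (\int[mu]_(th in D) (1 + cos th))); last first.
    by rewrite Rintegral_add1cos.
  apply: le_Rintegral => //.
    apply: integrableS (continuous_itv_integrable 0 pi continuous_add1cos) => //.
    exact: subset_itv_oo_cc.
  move=> th _; rewrite WE; apply: ler_piMl; last by rewrite expR_cos_le1 // addr_ge0.
  by have := cos_geN1 th; lra.
rewrite /sigma; case: eqP => [//|/eqP tn0].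
rewrite le_min le1 /=.
have tp : 0 < t by rewrite lt_neqAle eq_sym tn0.
pose q := Num.sqrt t.
have q0 : 0 < q by rewrite sqrtr_gt0.
have qq : q * q = t by rewrite -expr2 sqr_sqrtr.
(* [H] is a primitive of the majorant [f] of the integrand.  The lower bound -1
   makes [P] differentiable at [0] too. *)
pose P z := \int[mu]_(r in `[-1, z]) gauss_fun r.
pose H th := 2 / q * P (2 * q * sin (th / 2)).
pose f th : R := 2 * cos (th / 2) * gauss_fun (2 * q * sin (th / 2)).
pose g th : R := 2 * q * sin (th / 2).
have dH (x : R) : 0 <= x -> x <= pi -> is_derive x 1 H (f x).
  move=> x0 xpi.
  have g0 : -1 < g x.
    rewrite (@lt_le_trans _ _ 0) ?ltrN10 // mulr_ge0 ?mulr_ge0 ?(ltW q0) //.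
    by apply: sin_ge0_pi; lra.
  have dP := is_derive_primitive (@continuous_gauss_fun R) g0.
  have dg : is_derive x 1 g (q * cos (x / 2)).
    by rewrite /g; apply: is_derive_eq; rewrite /GRing.scale /=; field.
  have dPg := is_derive1_comp dP dg.
  have dPg' : is_derive x 1 (fun th => P (g th)) (gauss_fun (g x) * (q * cos (x / 2))).
    exact: dPg.
  rewrite /H; apply: is_derive_eq; rewrite /GRing.scale /= /f -/(g x).
  by field; rewrite gt_eqF.
have cf : continuous f.
  have ch : continuous (fun th : R => th / 2) by exact: continuous_funM.
  have cs := @continuous_fun_comp R _ sin ch (@continuous_sin R).
  have cc := @continuous_fun_comp R _ cos ch (@continuous_cos R).
  have cg : continuous g by exact: continuous_funM.
  apply: continuous_funM; first exact: continuous_funM.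
  exact: (@continuous_fun_comp R g gauss_fun cg (@continuous_gauss_fun R)).
have intf : \int[mu]_(th in D) f th <= Num.sqrt pi / q.
  rewrite (Rintegral_oo_pi_FTC cf dH) /H mul0r sin0 mulr0 sin_pihalf mulr1 -mulrBr.
  rewrite /P (Rintegral_segmentB (@continuous_gauss_fun R)) //; last first.
    by rewrite mulr_ge0 // ltW.
  have := integral0_gauss_le (2 * q); rewrite mulrAC => H1.
  by rewrite ler_pM2r ?invr_gt0 //; lra.
have Wf : \int[mu]_(th in D) kerW t t th <= \int[mu]_(th in D) f th.
  apply: le_Rintegral => //.
    apply: integrableS (continuous_itv_integrable 0 pi cf) => //.
    exact: subset_itv_oo_cc.
  move=> th; rewrite /D /= in_itv /= => /andP[th0 thpi]; rewrite WE /f.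
  have := cos_mulr2n (th / 2); have -> : th / 2 *+ 2 = th by field.
  set C := cos (th / 2); set S := sin (th / 2) => cE.
  have C0 : 0 <= C by apply: cos_ge0_pihalf; lra.
  have C1 : C <= 1 by exact: cos_le1.
  have SC : S ^+ 2 = 1 - C ^+ 2 by exact: sin2cos2.
  have -> : expR (- ((1 - cos th) * (t + t))) = gauss_fun (2 * q * S).
    rewrite /gauss_fun !exprMn SC cE -qq; congr expR; ring.
  (* One of the two factors [C = cos (th / 2)] is bounded by 1. *)
  have -> : 1 + cos th = 2 * C * C by rewrite cE; ring.
  rewrite mulrC ler_wpM2r ?gauss_fun_ge0 //.
  by rewrite ler_piMr // mulr_ge0.
rewrite /Wker mulrC ler_pdivrMr ?pi_gt0 //.
apply: (le_trans Wf); apply: (le_trans intf).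
rewrite sqrtrM ?pi_ge0 // -/q.
have sp0 : 0 < Num.sqrt pi :> R by rewrite sqrtr_gt0 pi_gt0.
have spE : Num.sqrt pi * Num.sqrt pi = pi :> R by rewrite -expr2 sqr_sqrtr ?pi_ge0.
rewrite -[X in _ <= _ * X]spE le_eqVlt; apply/orP; left; apply/eqP.
by field; rewrite !gt_eqF.
Qed.

End kernel_values.

(** * The comparison functions *)

Lemma continuous_bounded {R : realType} (f : R -> R) (a b : R) : continuous f ->
  exists2 M : R, 0 <= M & forall x, a <= x -> x <= b -> `|f x| <= M.
Proof.
move=> cf; have [ab|ba] := leP a b; last first.
  by exists 0 => // x ax xb; have := le_lt_trans (le_trans ax xb) ba; rewrite ltxx.
have cn : {within `[a, b], continuous (fun x => `|f x|)}.
  apply: continuous_subspaceT => x.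
  exact: (continuous_comp (cf x) (@norm_continuous _ _ _)).
have [c _ H] := EVT_max ab cn; exists `|f c| => // x ax xb.
by apply: H; rewrite in_itv /= ax.
Qed.

Lemma lipschitz_continuousR {R : realType} (f : R -> R) (L : R) :
  (forall x y, `|f x - f y| <= L * `|x - y|) -> continuous f.
Proof.
move=> fL x; apply/cvgrPdist_le => e e0.
have L0 : 0 < `|L| + 1 by rewrite ltr_wpDl.
near=> y; apply: (le_trans (fL x y)).
apply: (@le_trans _ _ ((`|L| + 1) * `|x - y|)).
  by rewrite ler_wpM2r // (le_trans (ler_norm L)) // lerDl.
rewrite mulrC -ler_pdivlMr //.
near: y; apply: cvgr_dist_le => //; exact: divr_gt0.
Unshelve. all: by end_near. Qed.

Section comparison_functions.
Context {R : realType}.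
Notation mu := (@lebesgue_measure R).
Variables (e : R -> R) (k : R).
Hypothesis ce : continuous e.
Hypothesis e0 : forall t, 0 <= e t.
Hypothesis k0 : 0 <= k.
Implicit Types (s t x y c z a b : R).

Let mI a b : measurable (`[a, b]%classic : set R).
Proof. exact: measurable_itv. Qed.

Let muI a b : a <= b -> mu `[a, b] = (b - a)%:E.
Proof.
move=> ab; rewrite lebesgue_measure_itv /= lte_fin.
by case: ltgtP ab => // -> _; rewrite subrr.
Qed.

Let muIfin a b : (mu `[a, b] < +oo)%E.
Proof.
rewrite lebesgue_measure_itv /=; case: ifP => _; last exact: ltry.
by rewrite -EFinB ltry.
Qed.

Lemma continuous_bounded_measurable (f : R -> R) a b : continuous f ->
  bounded_measurable `[a, b] f.
Proof.
move=> cf; split.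
  by apply: measurable_funTS; exact: continuous_measurable_fun.
have [M _ HM] := continuous_bounded a b cf.
by exists M => x /=; rewrite in_itv /= => /andP[]; exact: HM.
Qed.

Lemma eq_bounded_measurable (D : set R) (f g : R -> R) : (forall x, D x -> f x = g x) ->
  bounded_measurable D f -> bounded_measurable D g.
Proof.
move=> fg [mf [M HM]]; split.
  by apply: eq_measurable_fun mf => x; rewrite inE; exact: fg.
by exists M => x Dx; rewrite -fg // HM.
Qed.

(** The integrands of the convolutions below are considered only where both
    [s - r + (t - r)] is nonnegative, that is, up to [z] with [z + z <= s + t]. *)
Lemma bounded_measurable_convolution (K : R -> R -> R) (L : R) :
  0 <= L ->
  (forall s t s' t', t' - s' = t - s -> 0 <= s + t -> 0 <= s' + t' ->
    `|K s t - K s' t'| <= L * `|(s + t) - (s' + t')|) ->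
  forall s t a z, z + z <= s + t ->
  bounded_measurable `[a, z] (fun r => e r * K (s - r) (t - r)).
Proof.
move=> L0 KL s t a z zst.
(* Freezing the kernel beyond [z] makes it continuous on the whole line. *)
pose m (r : R) : R := Num.min r z.
have mz r : m r <= z by rewrite /m ge_min lexx orbT.
apply: (@eq_bounded_measurable _ (fun r => e r * K (s - m r) (t - m r))).
  by move=> r /=; rewrite in_itv /= => /andP[_ rz]; rewrite /m min_l.
apply: bounded_measurableM; first exact: continuous_bounded_measurable.
apply: continuous_bounded_measurable.
apply: (@lipschitz_continuousR _ _ (L * 2)) => x y.
have mx := mz x; have my := mz y.
apply: (le_trans (KL _ _ _ _ _ _ _)); [by ring|by lra|by lra|].
have -> : s - m x + (t - m x) - (s - m y + (t - m y)) = 2 * (m y - m x) by ring.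
rewrite normrM ger0_norm // mulrA ler_wpM2l ?mulr_ge0 //.
rewrite /m; case: (leP y z) => yz; case: (leP x z) => xz.
- by rewrite distrC.
- rewrite ler0_norm ?subr_le0 // ?ger0_norm; lra.
- rewrite ger0_norm ?ler0_norm; lra.
- by rewrite subrr normr0.
Qed.

Lemma bounded_measurable_convF s t a z : z + z <= s + t ->
  bounded_measurable `[a, z] (fun r => e r * Fker (s - r) (t - r)).
Proof.
apply: (@bounded_measurable_convolution _ 1) => // {}s {}t s' t' *; rewrite mul1r.
exact: Fker_lipschitz.
Qed.

Lemma bounded_measurable_convW s t a z : z + z <= s + t ->
  bounded_measurable `[a, z] (fun r => e r * Wker (s - r) (t - r)).
Proof.
apply: (@bounded_measurable_convolution _ 4) => // {}s {}t s' t' *.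
exact: Wker_lipschitz.
Qed.

Lemma bounded_measurable_convG s t a z : z + z <= s + t ->
  bounded_measurable `[a, z] (fun r => e r * Gker (s - r) (t - r)).
Proof.
move=> zst; apply: eq_bounded_measurable (bounded_measurableD
  (bounded_measurable_convF a zst) (bounded_measurable_convW a zst)).
by move=> r _; rewrite GkerE mulrDr.
Qed.

Let Rintegral_split (f : R -> R) a x y : a <= x -> x <= y ->
  bounded_measurable `[a, y] f -> \int[mu]_(r in `[a, y]) f r =
    \int[mu]_(r in `[a, x]) f r + \int[mu]_(r in `[x, y]) f r.
Proof.
move=> ax xy bf.
have if_ := bounded_measurable_integrable (mI a y) (muIfin a y) bf.
have := @Rintegral_itvB R f (BLeft a) (BRight y) x if_.
rewrite !bnd_simp => /(_ ax xy) H.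
rewrite -[LHS](subrK (\int[mu]_(r in `[a, x]) f r)) addrC; congr (_ + _).
rewrite H Rintegral_itv_obnd_cbnd //.
apply: integrableS if_ => //; move=> r /=; rewrite !in_itv /= => /andP[xr ->].
by rewrite (le_trans ax (ltW xr)).
Qed.

(** A primitive of [e]; only its increments on the half-line matter, and the
    lower bound -1 makes it differentiable at [0] too. *)
Definition prim x : R := \int[mu]_(r in `[-1, x]) e r.
(** Superpositions of the kernels started at time [r] with weight [e r]. *)
Definition convF s t : R := \int[mu]_(r in `[0, s]) (e r * Fker (s - r) (t - r)).
Definition convW s t : R := \int[mu]_(r in `[0, s]) (e r * Wker (s - r) (t - r)).
Definition convG s t : R := \int[mu]_(r in `[0, s]) (e r * Gker (s - r) (t - r)).

(** [increment_bound s t] will bound the distance between [u s] and [u t], and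
    [image_bound s t] the distance between [u s] and [T (u t)], for [s <= t].
    They solve the system

      d_t increment_bound + increment_bound = image_bound + e t,
      d_s image_bound + image_bound = increment_bound + e s,

    with [increment_bound s s = 0] and [k <= image_bound 0 t]; [bound_rate] is
    d_t increment_bound - e t. *)
Definition increment_bound s t : R := k * Fker s t + 2 * convF s t + (prim t - prim s).
Definition bound_rate s t : R := k * Wker s t + 2 * convW s t.
Definition image_bound s t : R := increment_bound s t + bound_rate s t.

Lemma convGE s t : s <= t -> convG s t = convF s t + convW s t.
Proof.
move=> st; have sst : s + s <= s + t by rewrite lerD2l.
rewrite /convG /convF /convW -RintegralD //.
- by apply: eq_Rintegral => r _; rewrite GkerE mulrDr.
- exact: (bounded_measurable_integrable (mI _ _) (muIfin _ _)
    (bounded_measurable_convF _ sst)).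
- exact: (bounded_measurable_integrable (mI _ _) (muIfin _ _)
    (bounded_measurable_convW _ sst)).
Qed.

Lemma image_boundE s t : s <= t ->
  image_bound s t = k * Gker s t + 2 * (convG s t - prim s) + (prim t + prim s).
Proof.
move=> st; rewrite /image_bound /increment_bound /bound_rate convGE // GkerE.
by ring.
Qed.

Lemma prim_has_slope a b c : 0 <= a -> a <= c -> c <= b -> has_slope prim a b c (e c).
Proof.
move=> a0 ac cb; apply: is_derive_has_slope => //.
apply: is_derive_primitive => //.
by rewrite (@lt_le_trans _ _ 0) ?ltrN10 // (le_trans a0).
Qed.

Lemma increment_bound_diag s : 0 <= s -> increment_bound s s = 0.
Proof.
move=> s0; rewrite /increment_bound Fker_diag mulr0 subrr addr0 add0r /convF.
rewrite (_ : \int[mu]_(r in _) _ = \int[mu]_(r in `[0, s]) 0).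
  by rewrite Rintegral_cst // mul0r mulr0.
by apply: eq_Rintegral => r _; rewrite Fker_diag mulr0.
Qed.

Lemma prim_le s t : 0 <= s -> s <= t -> prim s <= prim t.
Proof.
move=> s0 st; rewrite -subr_ge0 /prim Rintegral_segmentB //.
  exact: Rintegral_ge0.
by rewrite (@le_trans _ _ 0) ?lerN10.
Qed.

Lemma image_bound0_ge t : 0 <= t -> k <= image_bound 0 t.
Proof.
move=> t0; rewrite image_boundE // Gker0 // mulr1 /convG set_itv1 Rintegral_set1.
by have := prim_le (lexx 0) t0; lra.
Qed.

(** The first equation of the system; see [image_bound]. *)
Lemma increment_bound_has_slope s b c : 0 <= s -> s <= c -> c <= b ->
  has_slope (increment_bound s) s b c (bound_rate s c + e c).
Proof.
move=> s0 sc cb.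
have [M M0 HM] := continuous_bounded 0 s ce.
have sF : has_slope (Fker s) s b c (Wker s c).
  apply: (@has_slope_quadratic _ R 6) => x y sx xc cy yb.
  by apply: Fker_taylor => //; lra.
have sC : has_slope (convF s) s b c (convW s c).
  apply: (@has_slope_quadratic _ R (M * 6 * s)) => x y sx xc cy yb.
  have bF1 := @bounded_measurable_convF s y 0 s ltac:(lra).
  have bF2 := @bounded_measurable_convF s x 0 s ltac:(lra).
  have bW1 := @bounded_measurable_convW s c 0 s ltac:(lra).
  rewrite /GRing.scale /= /convF /convW (Rintegral_lin (mI _ _) (muIfin _ _)).
  - apply: (le_trans (bounded_Rintegral (B := M * (6 * (y - x) ^+ 2))
      (mI _ _) (muIfin _ _) _ _)).
    + apply: (bounded_measurableB (bounded_measurableB bF1 bF2)).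
      exact: (bounded_measurableM (bounded_measurable_cst _ _) bW1).
    + move=> r /=; rewrite in_itv /= => /andP[r0 rs].
      have -> : e r * Fker (s - r) (y - r) - e r * Fker (s - r) (x - r) -
          (y - x) * (e r * Wker (s - r) (c - r)) =
          e r * (Fker (s - r) (y - r) - Fker (s - r) (x - r) -
            ((y - r) - (x - r)) * Wker (s - r) (c - r)) by ring.
      rewrite normrM ler_pM //; first exact: HM.
      rewrite (_ : y - x = (y - r) - (x - r)); last by ring.
      by apply: Fker_taylor; lra.
    + by rewrite muI //= subr0 le_eqVlt; apply/orP; left; apply/eqP; ring.
  - exact: bF1.
  - exact: bF2.
  - exact: bW1.
have sP : has_slope prim s b c (e c) by exact: prim_has_slope.
have H1 := has_slopeD (has_slopeD (has_slopeZ k sF) (has_slopeZ 2 sC))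
  (has_slopeD sP (has_slope_cst (- prim s) s b c)).
by rewrite addr0 in H1.
Qed.

Let Gker_near s t : 0 <= s -> s <= t -> `|Gker s t - 1| <= (2 + 6 * s) * s.
Proof.
move=> s0 st.
have := @Gker_taylor R t 0 0 s (lexx 0) s0; rewrite add0r => /(_ (le_trans s0 st)).
rewrite Gker0 ?(le_trans s0) // subr0 => H.
have := @Wker_le R 0 t; rewrite add0r => /(_ (le_trans s0 st)) HW.
have -> : Gker s t - 1 = (Gker s t - 1 + s * Wker 0 t) - s * Wker 0 t by ring.
apply: (le_trans (ler_normB _ _)).
rewrite [X in _ + X]normrM (ger0_norm s0).
have := ler_wpM2l s0 HW; lra.
Qed.

(** Moving the upper limit of the convolution contributes [e c * Gker 0 (t - c)],
    which is [e c] because [Gker 0] is constant equal to 1: this is the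
    derivative of [prim], which is subtracted. *)
Lemma convG_has_slope t b c : 0 <= c -> c <= b -> b <= t ->
  has_slope (fun s => convG s t - prim s) 0 b c (- convW c t).
Proof.
move=> c0 cb bt.
have [M M0 HM] := continuous_bounded 0 t ce.
apply: (@has_slope_quadratic _ R (M * (12 * t + 4))) => x y x0 xc cy yb.
have xy : x <= y by lra.
have yt : y <= t by lra.
have xyt : x + x <= y + t by lra.
have xxt : x + x <= x + t by lra.
have xct : x + x <= c + t by lra.
have cct : c + c <= c + t by lra.
have yyt : y + y <= y + t by lra.
have xt : x <= t by lra.
have t0 : 0 <= t by lra.
have I1 : `|\int[mu]_(r in `[0, x]) (e r * Gker (y - r) (t - r)) - convG x t
   - (- (y - x)) * \int[mu]_(r in `[0, x]) (e r * Wker (c - r) (t - r))|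
   <= M * (6 * (y - x) ^+ 2) * x.
  have bG1 := @bounded_measurable_convG y t 0 x xyt.
  have bG2 := @bounded_measurable_convG x t 0 x xxt.
  have bW1 := @bounded_measurable_convW c t 0 x xct.
  rewrite /convG (Rintegral_lin (mI _ _) (muIfin _ _)).
  - apply: (le_trans (bounded_Rintegral (B := M * (6 * (y - x) ^+ 2))
      (mI _ _) (muIfin _ _) _ _)).
    + apply: (bounded_measurableB (bounded_measurableB bG1 bG2)).
      exact: (bounded_measurableM (bounded_measurable_cst _ _) bW1).
    + move=> r /=; rewrite in_itv /= => /andP[r0 rs].
      have -> : e r * Gker (y - r) (t - r) - e r * Gker (x - r) (t - r) -
          - (y - x) * (e r * Wker (c - r) (t - r)) =
          e r * (Gker (y - r) (t - r) - Gker (x - r) (t - r) +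
            ((y - r) - (x - r)) * Wker (c - r) (t - r)) by ring.
      rewrite normrM ler_pM //; first by apply: HM; lra.
      rewrite (_ : y - x = (y - r) - (x - r)); last by ring.
      by apply: Gker_taylor; lra.
    + by rewrite muI //= subr0.
  - exact: bG1.
  - exact: bG2.
  - exact: bW1.
have I2 : `|\int[mu]_(r in `[x, c]) (e r * Wker (c - r) (t - r))| <= M * 2 * (y - x).
  apply: (le_trans (bounded_Rintegral (B := M * 2)
      (mI _ _) (muIfin _ _) _ _)).
  - exact: (@bounded_measurable_convW c t x c cct).
  - move=> r /=; rewrite in_itv /= => /andP[r0 rs].
    by rewrite normrM ler_pM //; [apply: HM; lra|apply: Wker_le; lra].
  - by rewrite muI //= ler_wpM2l ?mulr_ge0 //; lra.
have I3 : `|\int[mu]_(r in `[x, y]) (e r * Gker (y - r) (t - r)) - (prim y - prim x)|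
    <= M * ((2 + 6 * t) * (y - x)) * (y - x).
  have bmGy := @bounded_measurable_convG y t x y yyt.
  have bme := continuous_bounded_measurable x y ce.
  rewrite /prim Rintegral_segmentB //; last by lra.
  rewrite -RintegralB //;
    try exact: (bounded_measurable_integrable (mI _ _) (muIfin _ _)).
  apply: (le_trans (bounded_Rintegral (B := M * ((2 + 6 * t) * (y - x)))
      (mI _ _) (muIfin _ _) _ _)).
  - exact: bounded_measurableB.
  - move=> r /=; rewrite in_itv /= => /andP[r0 rs].
    rewrite -[X in _ - X]mulr1 -mulrBr normrM ler_pM //; first by apply: HM; lra.
    apply: (le_trans (Gker_near _ _)); [lra|lra|].
    by apply: ler_pM; nra.
  - by rewrite muI.
have convGsplit : convG y t = \int[mu]_(r in `[0, x]) (e r * Gker (y - r) (t - r))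
    + \int[mu]_(r in `[x, y]) (e r * Gker (y - r) (t - r)).
  exact: (Rintegral_split x0 xy (@bounded_measurable_convG y t 0 y yyt)).
have convWsplit : convW c t = \int[mu]_(r in `[0, x]) (e r * Wker (c - r) (t - r))
    + \int[mu]_(r in `[x, c]) (e r * Wker (c - r) (t - r)).
  exact: (Rintegral_split x0 xc (@bounded_measurable_convW c t 0 c cct)).
rewrite /GRing.scale /= convGsplit convWsplit {convGsplit convWsplit}.
set A := \int[mu]_(r in `[0, x]) _ in I1 *.
set B := \int[mu]_(r in `[x, y]) _ in I3 *.
set C := \int[mu]_(r in `[0, x]) _ in I1 *.
set E := \int[mu]_(r in `[x, c]) _ in I2 *.
have -> : A + B - prim y - (convG x t - prim x) - (y - x) * (- (C + E)) =
  (A - convG x t - (- (y - x)) * C) + (B - (prim y - prim x)) + (y - x) * E by ring.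
apply: (le_trans (ler_normD _ _)).
apply: (le_trans (lerD (le_trans (ler_normD _ _) (lerD I1 I3)) (lexx _))).
rewrite normrM ger0_norm ?subr_ge0 //.
have := ler_wpM2l (_ : 0 <= y - x) I2; rewrite subr_ge0 => /(_ xy) I2'.
apply: (le_trans (lerD (lexx _) I2')).
rewrite -subr_ge0.
have -> : M * (12 * t + 4) * (y - x) ^+ 2 -
    (M * (6 * (y - x) ^+ 2) * x + M * ((2 + 6 * t) * (y - x)) * (y - x) +
     (y - x) * (M * 2 * (y - x))) = 6 * M * (y - x) ^+ 2 * (t - x) by ring.
by rewrite !mulr_ge0 ?sqr_ge0 ?subr_ge0.
Qed.

(** The second equation of the system. *)
Lemma image_bound_has_slope t b c : 0 <= c -> c <= b -> b <= t ->
  has_slope (fun s => image_bound s t) 0 b c (e c - bound_rate c t).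
Proof.
move=> c0 cb bt.
have sG : has_slope (fun s => Gker s t) 0 b c (- Wker c t).
  apply: (@has_slope_quadratic _ R 6) => x y x0 xc cy yb.
  by rewrite scalerN opprK; apply: Gker_taylor => //; lra.
have sC := convG_has_slope c0 cb bt.
have sP : has_slope prim 0 b c (e c) by exact: prim_has_slope.
have H1 := has_slopeD (has_slopeD (has_slopeZ k sG) (has_slopeZ 2 sC))
  (has_slopeD (has_slope_cst (prim t) 0 b c) sP).
move=> f f0; have [r r0 hr] := H1 f f0; exists r => // x y x0 xc cy yb yr.
have := hr x y x0 xc cy yb yr; rewrite !image_boundE; [|lra|lra].
rewrite /GRing.scale /= (_ : k * - _ + _ + _ = e c - bound_rate c t) //.
by rewrite /bound_rate; ring.
Qed.

(** A crude lower bound, only needed to start the iteration. *)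
Lemma increment_bound_lower A : 0 <= A -> exists C,
  forall s t, 0 <= s -> s <= t -> t <= A ->
  C <= increment_bound s t.
Proof.
move=> A0; have [M M0 HM] := continuous_bounded 0 A ce.
exists (- (k * (2 * A) + 2 * (M * (2 * A) * A))) => s t s0 st tA.
have F1 : `|Fker s t| <= 2 * A.
  apply: (le_trans (Fker_le _)); first by lra.
  by rewrite ler_wpM2l // ger0_norm; lra.
have F2 : `|convF s t| <= M * (2 * A) * A.
  apply: (le_trans (bounded_Rintegral (B := M * (2 * A))
      (mI _ _) (muIfin _ _) _ _)).
  - exact: (@bounded_measurable_convF s t 0 s ltac:(lra)).
  - move=> r /=; rewrite in_itv /= => /andP[r0 rs].
    rewrite normrM ler_pM //; first by apply: HM; lra.
    apply: (le_trans (Fker_le _)); first by lra.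
    by rewrite ler_wpM2l // ger0_norm; lra.
  - by rewrite muI //= ler_wpM2l ?mulr_ge0 //; lra.
have := prim_le s0 st; rewrite /increment_bound.
move: F1 F2 => /ler_normlP[F1 _] /ler_normlP[F2 _].
have := ler_wpM2l k0 F1; lra.
Qed.

End comparison_functions.

(** * Comparison with the solution *)

(** If some error is admissible, and an admissible error [del] can always be
    improved to [q * del] with [q < 1], then there is no error. *)
Lemma contraction_bound {R : realType} (I : Type) (dom : I -> Prop) (phi d : I -> R)
    (q delta : R) : 0 <= q -> q < 1 -> 0 <= delta ->
  (forall i, dom i -> phi i <= d i + delta) ->
  (forall del, 0 <= del -> (forall i, dom i -> phi i <= d i + del) ->
     forall i, dom i -> phi i <= d i + q * del) ->
  forall i, dom i -> phi i <= d i.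
Proof.
move=> q0 q1 delta0 H0 HS i di.
have H n : forall i, dom i -> phi i <= d i + delta * q ^+ n.
  elim: n => [|n IH]; first by rewrite expr0 mulr1.
  rewrite exprS mulrCA; apply: HS => //.
  by rewrite mulr_ge0 // exprn_ge0.
apply/ler_addgt0Pr => e e0.
have qn : `|q| < 1 by rewrite ger0_norm.
have /cvgrPdist_le /(_ e e0) [N _ HN] := cvg_geometric delta qn.
apply: (le_trans (H N i di)); rewrite lerD2l.
have := HN N (leqnn N); rewrite /= sub0r normrN.
exact: le_trans (ler_norm _).
Qed.

Lemma has_slope_bounded {R : realType} {V : normedModType R} (g l : R -> V) (b : R) :
  0 <= b -> (forall c, 0 <= c -> c <= b -> has_slope g 0 b c (l c)) ->
  exists2 M : R, 0 <= M & forall t, 0 <= t -> t <= b -> `|g t| <= M.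
Proof.
move=> b0 sg.
(* [cl] is the projection of the line onto [[0, b]]. *)
pose cl (x : R) : R := Num.max 0 (Num.min x b).
have cl0 x : 0 <= cl x by rewrite /cl le_max lexx.
have clb x : cl x <= b by rewrite /cl ge_max b0 ge_min lexx orbT.
have clE x : 0 <= x -> x <= b -> cl x = x by move=> x0 xb; rewrite /cl min_l // max_r.
have clL x y : `|cl x - cl y| <= `|x - y|.
  wlog xy : x y / x <= y => [hw|].
    have [xy|/ltW yx] := leP x y; first exact: hw.
    by rewrite distrC (distrC x); exact: hw.
  have clm : cl x <= cl y.
    rewrite /cl; case: (leP x b) => xb; case: (leP y b) => yb;
      rewrite ?(max_r b0); case: (leP 0 x) => h1; case: (leP 0 y) => h2; lra.
  rewrite distrC (distrC x) !ger0_norm ?subr_ge0 //.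
  rewrite /cl; case: (leP x b) => xb; case: (leP y b) => yb;
    rewrite ?(max_r b0); case: (leP 0 x) => h1; case: (leP 0 y) => h2; lra.
have cg : continuous (fun x => `|g (cl x)|).
  move=> x; apply/cvgrPdist_le => e e0.
  have [r r0 hr] := has_slope_continuous (cl0 x) (clb x) (sg _ (cl0 x) (clb x)) e0.
  near=> y; apply: (le_trans (ler_dist_dist _ _)); rewrite distrC.
  apply: hr => //; apply: (le_lt_trans (clL y x)); rewrite distrC.
  by near: y; exact: cvgr_dist_lt.
have [M M0 HM] := continuous_bounded 0 b cg.
exists M => // t t0 tb; have := HM t t0 tb.
by rewrite clE // normr_id.
Unshelve. all: by end_near. Qed.

(** Slopes inherit the inequality between increments to the right of [c]. *)
Lemma has_slope_le {R : realType} {V : normedModType R} (g : R -> V) (h : R -> R)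
    (b c m : R) (l : V) : c < b -> has_slope g c b c l -> has_slope h c b c m ->
  (forall y, c <= y -> y <= b -> `|g y - g c| <= h y - h c) -> `|l| <= m.
Proof.
move=> cb sg sh gh; apply/ler_addgt0Pr => e e0.
have e20 : 0 < e / 2 by rewrite divr_gt0.
have [r1 r10 h1] := sg _ e20; have [r2 r20 h2] := sh _ e20.
pose d := Num.min (b - c) (Num.min r1 r2) / 2.
have m0 : 0 < Num.min (b - c) (Num.min r1 r2) by rewrite !lt_min r10 r20 subr_gt0 cb.
have d0 : 0 < d by rewrite divr_gt0.
have : Num.min (b - c) (Num.min r1 r2) <= b - c by rewrite ge_min lexx.
have : Num.min (b - c) (Num.min r1 r2) <= r1 by rewrite !ge_min lexx orbT.
have : Num.min (b - c) (Num.min r1 r2) <= r2 by rewrite !ge_min lexx !orbT.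
move: d0 m0; rewrite /d; move: (Num.min _ _) => M d0 M0 Mr2 Mr1 Mb.
have E : c + M / 2 - c = M / 2 by ring.
have {}h1 := h1 c (c + M / 2) (lexx _) (lexx _) ltac:(lra) ltac:(lra) ltac:(lra).
have {}h2 := h2 c (c + M / 2) (lexx _) (lexx _) ltac:(lra) ltac:(lra) ltac:(lra).
have {}gh := gh (c + M / 2) ltac:(lra) ltac:(lra).
rewrite E in h1 h2.
have H : `|(M / 2) *: l| <= (h (c + M / 2) - h c) + e / 2 * (M / 2).
  have -> : (M / 2) *: l = (g (c + M / 2) - g c) - (g (c + M / 2) - g c - (M / 2) *: l).
    by rewrite opprB addrC subrK.
  by apply: (le_trans (ler_normB _ _)); apply: lerD.
rewrite normrZ (ger0_norm (ltW d0)) in H.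
move: h2; rewrite /GRing.scale /= => /ler_normlP[_ h2].
rewrite -(ler_pM2l d0); lra.
Qed.

Section comparison.
Context {R : realType} {X : normedModType R}.
Notation mu := (@lebesgue_measure R).
Variables (T : X -> X) (f u : R -> X) (e : R -> R).
Hypothesis Tne : nonexpansive T.
Hypothesis ce : continuous e.
Hypothesis e0 : forall t, 0 <= e t.
Hypothesis fe : forall t, 0 <= t -> `|f t| <= e t.
Hypothesis su : forall b c, 0 <= c -> c <= b ->
  has_slope u 0 b c (f c - (u c - T (u c))).

Let su_sub a b c (p : X) : 0 <= a -> a <= c -> c <= b ->
  has_slope (fun t => u t - p) a b c ((T (u c) + f c - p) - (u c - p)).
Proof.
move=> a0 ac cb.
have s1 := has_slope_subset a0 (lexx b) (su (le_trans a0 ac) cb).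
have := has_slopeD s1 (has_slope_cst (- p) a b c).
have -> // : f c - (u c - T (u c)) + 0 = T (u c) + f c - p - (u c - p).
rewrite addr0 !opprB addrA [RHS]addrA subrK (addrC (f c)).
by rewrite (addrAC _ (f c)).
Qed.

(** The distance to a fixed point grows at most at the rate [e]. *)
Lemma fixed_point_distance p : T p = p -> forall t, 0 <= t ->
  `|u t - p| <= `|u 0 - p| + (prim e t - prim e 0).
Proof.
move=> Tp A A0.
have [M M0 HM] := has_slope_bounded A0 (fun c c0 cA => su c0 cA).
pose h c := `|u 0 - p| + (prim e c - prim e 0).
have h0 c : 0 <= c -> 0 <= h c.
  by move=> c0; rewrite addr_ge0 // subr_ge0 prim_le.
have q0 : 0 <= 1 - expR (- A) by rewrite subr_ge0 -expR0 ler_expR oppr_le0.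
have q1 : 1 - expR (- A) < 1 by rewrite ltrBlDr ltrDl expR_gt0.
apply: (@contraction_bound R R (fun t => 0 <= t /\ t <= A) (fun t => `|u t - p|) h
  (1 - expR (- A)) (M + `|p|)) => //.
- by rewrite addr_ge0.
- move=> t [t0 tA]; apply: (le_trans (ler_normB _ _)).
  by rewrite -[X in X <= _]add0r lerD ?h0 // lerD2r HM.
move=> del del0 IH t [t0 tA].
have : `|u t - p| <= h t + del * (1 - expR (0 - t)).
  apply: (@damped_comparison R X (fun t => u t - p) (fun c => T (u c) + f c - p)
     h (fun c => h c + e c)) => //.
  - by move=> c c0 ct; exact: su_sub.
  - move=> c c0 ct.
    have := has_slopeD (has_slope_cst (`|u 0 - p| - prim e 0) 0 t c)
      (prim_has_slope ce (lexx 0) c0 ct).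
    rewrite add0r addrAC subrr add0r.
    suff -> : (fun t0 => `|u 0 - p| - prim e 0 + prim e t0) = h by [].
    by apply/funext => z; rewrite /h; ring.
  - move=> c c0 ct; rewrite addrAC.
    apply: (le_trans (ler_normD _ _)).
    have : `|T (u c) - p| <= h c + del.
      rewrite -[X in _ - X]Tp; apply: (le_trans (Tne _ _)).
      by apply: IH; split => //; exact: le_trans tA.
    by have := fe c0; lra.
  - by rewrite /h subrr addr0.
move/le_trans; apply; rewrite lerD2l mulrC ler_wpM2r // lerD2l lerN2 ler_expR.
by rewrite sub0r lerN2.
Qed.

Variable k : R.
Hypothesis Tk : forall t, 0 <= t -> `|T (u t) - u 0| <= k.

Let k0 : 0 <= k.
Proof. exact: le_trans (Tk (lexx 0)). Qed.

(** The comparison.  An error [del] in the bound of [u t - u s] gives, by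
    nonexpansiveness and damping in the first variable, the same error in the
    bound of [u s - T (u t)], and then, by damping in the second variable, a
    strictly smaller error in the bound of [u t - u s]. *)
Lemma increment_le s t : 0 <= s -> s <= t -> `|u t - u s| <= increment_bound e k s t.
Proof.
move=> s0 st.
have [M M0 HM] := has_slope_bounded (le_trans s0 st) (fun c c0 cA => su c0 cA).
have [C HC] := increment_bound_lower ce e0 k0 (le_trans s0 st).
pose A := t; have A0 : 0 <= A by exact: le_trans st.
have q0 : 0 <= 1 - expR (- A) by rewrite subr_ge0 -expR0 ler_expR oppr_le0.
have q1 : 1 - expR (- A) < 1 by rewrite ltrBlDr ltrDl expR_gt0.
apply: (@contraction_bound R (R * R)%type
  (fun p => [/\ 0 <= p.1, p.1 <= p.2 & p.2 <= A])
  (fun p => `|u p.2 - u p.1|) (fun p => increment_bound e k p.1 p.2)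
  (1 - expR (- A)) (M + M + `|C|) _ _ _ _ _ (s, t)) => //.
- by rewrite !addr_ge0.
- move=> [a b] [/= a0 ab bA]; apply: (le_trans (ler_normB _ _)).
  have := HC a b a0 ab bA; have := HM b (le_trans a0 ab) bA.
  have := HM a a0 (le_trans ab bA); have := ler_norm (- C); rewrite normrN; lra.
move=> del del0 IH [a b] [/= a0 ab bA].
have psi x y : 0 <= x -> x <= y -> y <= A ->
    `|u x - T (u y)| <= image_bound e k x y + del.
  move=> x0 xy yA.
  have : `|u x - T (u y)| <= image_bound e k x y + del * (1 - expR (0 - x)).
    apply: (@damped_comparison R X (fun c => u c - T (u y))
      (fun c => T (u c) + f c - T (u y)) (fun c => image_bound e k c y)
      (fun c => increment_bound e k c y + e c)) => //.
    - by move=> c c0 cx; exact: su_sub.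
    - move=> c c0 cx.
      have := image_bound_has_slope k ce c0 cx xy.
      suff -> : e c - bound_rate e k c y =
        increment_bound e k c y + e c - image_bound e k c y by [].
      by rewrite /image_bound; ring.
    - move=> c c0 cx; rewrite addrAC.
      apply: (le_trans (ler_normD _ _)).
      have : `|T (u c) - T (u y)| <= increment_bound e k c y + del.
        apply: (le_trans (Tne _ _)); rewrite distrC.
        by apply: (IH (c, y)); split => //=; exact: le_trans xy.
      by have := fe c0; lra.
    - rewrite distrC; apply: (le_trans (Tk (le_trans x0 xy))).
      by apply: image_bound0_ge => //; exact: le_trans xy.
  by have := mulr_ge0 del0 (expR_ge0 (0 - x)); lra.
have : `|u b - u a| <= increment_bound e k a b + del * (1 - expR (a - b)).
  apply: (@damped_comparison R X (fun c => u c - u a)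
      (fun c => T (u c) + f c - u a) (fun c => increment_bound e k a c)
      (fun c => image_bound e k a c + e c)) => //.
  - by move=> c ac cb; exact: su_sub.
  - move=> c ac cb.
    have := increment_bound_has_slope k ce a0 ac cb.
    suff -> : bound_rate e k a c + e c =
      image_bound e k a c + e c - increment_bound e k a c by [].
    by rewrite /image_bound; ring.
  - move=> c ac cb; rewrite addrAC.
    apply: (le_trans (ler_normD _ _)).
    have : `|T (u c) - u a| <= image_bound e k a c + del.
      by rewrite distrC; apply: psi => //; exact: le_trans bA.
    by have := fe (le_trans a0 ac); lra.
  - by rewrite subrr normr0 increment_bound_diag.
move/le_trans; apply; rewrite lerD2l mulrC ler_wpM2r // lerD2l lerN2 ler_expR; lra.
Qed.

(** The derivative of [u] is controlled by that of [increment_bound] on the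
    diagonal, where [increment_bound] vanishes. *)
Lemma velocity_le t : 0 <= t ->
  `|f t - (u t - T (u t))| <= bound_rate e k t t + e t.
Proof.
move=> t0.
have tt1 : t <= t + 1 by rewrite lerDl.
apply: (@has_slope_le R X u (increment_bound e k t) (t + 1) t).
- by rewrite ltrDl.
- exact: has_slope_subset t0 (lexx _) (su t0 tt1).
- exact: increment_bound_has_slope.
- by move=> y ty _; rewrite increment_bound_diag // subr0; exact: increment_le.
Qed.

End comparison.

(** * Data on the half-line *)

Lemma derivable_within_has_slope {R : realType} {X : normedModType R} (u : R -> X)
    (b c : R) : 0 <= c -> c <= b -> derivable_within u c ->
  has_slope u 0 b c (derive_within u c).
Proof.
move=> c0 cb du; apply: has_slope_at => // e e0.
have : quotient_within u c --> derive_within u c by exact: du.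
move/cvgrPdist_le => /(_ e e0); rewrite !near_withinE => /nbhs_ballP[r /= r0 hr].
exists r => // y y0 yb yc.
have [->|ync] := eqVneq y c.
  by rewrite !subrr scale0r subrr !normr0 mulr0.
have Hb : ball c r y by rewrite -ball_normE /= distrC.
have := hr y Hb ync; rewrite /= in_itv /= y0 => /(_ isT) H.
have ync' : y - c != 0 by rewrite subr_eq0.
have -> : u y - u c - (y - c) *: derive_within u c =
    (y - c) *: ((y - c)^-1 *: (u y - u c) - derive_within u c).
  by rewrite scalerBr scalerA divff // scale1r.
by rewrite normrZ mulrC ler_wpM2r // distrC.
Qed.

(** The even extension turns a function continuous on the half-line into one
    continuous on the whole line. *)
Lemma continuous_even_extension {R : realType} (f : R -> R) :
  {within `[0, +oo[, continuous f} -> continuous (fun t : R => f `|t|).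
Proof.
move/subspace_continuousP => cf x.
have x0 : (`[0, +oo[%classic : set R) `|x| by rewrite /= in_itv /= normr_ge0.
apply/cvgrPdist_le => e e0.
have /cvgrPdist_le /(_ e e0) := cf `|x| x0.
rewrite near_withinE => /nbhs_ballP[r /= r0 hr].
apply/nbhs_ballP; exists r => //= y xy.
apply: hr; last by rewrite /= in_itv /= normr_ge0.
exact: le_lt_trans (ler_dist_dist x y) xy.
Qed.

(** * Convolution with sigma *)

Section sigma_facts.
Context {R : realType}.
Implicit Types x y : R.

(** A continuous extension of [sigma] to the whole line; it is [1] up to
    [pi^-1], in particular at negative arguments. *)
Definition sigma_ext y : R := (Num.sqrt (Num.max 1 (pi * y)))^-1.

Lemma sigmaE y : 0 <= y -> sigma y = sigma_ext y.
Proof.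
move=> y0; rewrite /sigma /sigma_ext; case: eqP => [->|/eqP yn0].
  by rewrite mulr0 max_l // sqrtr1 invr1.
have yp : 0 < y by rewrite lt_neqAle eq_sym yn0.
have py : 0 < pi * y by rewrite mulr_gt0 // pi_gt0.
have [h|h] := leP 1 (pi * y).
  rewrite min_r // invf_le1 ?sqrtr_gt0 //.
  by rewrite -sqrtr1 ler_sqrt // (le_trans _ h).
rewrite sqrtr1 invr1 min_l // invf_ge1 ?sqrtr_gt0 //.
by rewrite -[X in _ <= X]sqrtr1 ler_sqrt // ltW.
Qed.

Let max_gt0 y : 0 < Num.max 1 (pi * y).
Proof. by rewrite lt_max ltr01. Qed.

Lemma sigma_ext_ge0 y : 0 <= sigma_ext y.
Proof. by rewrite invr_ge0 sqrtr_ge0. Qed.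

Lemma sigma_ext_le1 y : sigma_ext y <= 1.
Proof.
rewrite invf_le1 ?sqrtr_gt0 ?max_gt0 //.
by rewrite -[X in X <= _]sqrtr1; apply: ler_wsqrtr; rewrite le_max lexx.
Qed.

Lemma sigma_ext_anti x y : x <= y -> sigma_ext y <= sigma_ext x.
Proof.
move=> xy; rewrite lef_pV2 ?posrE ?sqrtr_gt0 ?max_gt0 //.
apply: ler_wsqrtr; rewrite ge_max le_max lexx /= le_max.
by rewrite ler_pM2l ?pi_gt0 // xy orbT.
Qed.

Lemma continuous_sigma_ext : continuous sigma_ext.
Proof.
move=> y; apply: cvgV; first by rewrite gt_eqF // sqrtr_gt0 max_gt0.
apply: (@continuous_comp _ _ _ (fun y => Num.max 1 (pi * y)) Num.sqrt).
  apply: (@lipschitz_continuousR _ _ pi) => {}x {}y.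
  rewrite -[pi in X in _ <= X]ger0_norm ?pi_ge0 // -normrM mulrBr.
  move: (pi * x) (pi * y) => a b.
  case: (leP 1 a) => ha; case: (leP 1 b) => hb.
  - by [].
  - by rewrite !ger0_norm; lra.
  - by rewrite !ler0_norm; lra.
  - by rewrite subrr normr0.
exact: sqrt_continuous.
Qed.

Lemma sigma_ext_small (h : R) : 0 < h ->
  exists2 Y, 0 <= Y & forall y, Y <= y -> sigma_ext y <= h.
Proof.
move=> h0; exists (h^-1 ^+ 2); first by rewrite sqr_ge0.
move=> y hy; rewrite -[h]invrK lef_pV2 ?posrE ?invr_gt0 ?sqrtr_gt0 ?max_gt0 //.
have -> : h^-1 = Num.sqrt (h^-1 ^+ 2) by rewrite sqrtr_sqr ger0_norm // invr_ge0 ltW.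
apply: ler_wsqrtr; rewrite le_max; apply/orP; right.
apply: (le_trans hy); rewrite ler_peMl //.
  by apply: le_trans hy; exact: sqr_ge0.
by have := @pi_ge2 R; lra.
Qed.

End sigma_facts.

Section bound_rate_bounds.
Context {R : realType}.
Notation mu := (@lebesgue_measure R).
Variables (e : R -> R) (k : R).
Hypothesis ce : continuous e.
Hypothesis e0 : forall t, 0 <= e t.
Hypothesis k0 : 0 <= k.

Lemma continuous_sigma_convolution t : continuous (fun s => e s * sigma_ext (t - s)).
Proof.
apply: continuous_funM => //.
apply: (@continuous_fun_comp _ _ (@sigma_ext R)); last exact: continuous_sigma_ext.
apply: continuous_funD; first exact: continuous_fun_cst.
by apply: continuous_funN; exact: continuous_fun_id.
Qed.
Let csig := continuous_sigma_convolution.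

Lemma bound_rate_diag_le t : 0 <= t -> bound_rate e k t t <=
  k * sigma t + 2 * \int[mu]_(s in `[0, t]) (e s * sigma_ext (t - s)).
Proof.
move=> t0; rewrite /bound_rate lerD ?ler_wpM2l ?Wker_diag_le_sigma //.
rewrite /convW; apply: le_Rintegral => //.
- apply: bounded_measurable_integrable.
  + exact: measurable_itv.
  + by rewrite lebesgue_measure_itv /=; case: ifP => _; rewrite ?ltry // -EFinB ltry.
  + exact: bounded_measurable_convW.
- exact: continuous_itv_integrable.
move=> s /=; rewrite in_itv /= => /andP[s0 st].
by rewrite ler_wpM2l // -sigmaE ?subr_ge0 // Wker_diag_le_sigma // subr_ge0.
Qed.

(** Up to time [t / 2] the factor [sigma_ext] is small, and after that time the
    remaining mass of [e] is. *)
Lemma sigma_convolution_le t : 0 <= t ->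
  \int[mu]_(s in `[0, t]) (e s * sigma_ext (t - s)) <=
  sigma_ext (t / 2) * \int[mu]_(s in `[0, t / 2]) e s
  + \int[mu]_(s in `[t / 2, t]) e s.
Proof.
move=> t0.
have h0 : 0 <= t / 2 by lra.
have ht : t / 2 <= t by lra.
have := Rintegral_segmentB (@csig t) h0 ht.
move/eqP; rewrite subr_eq => /eqP ->; rewrite addrC; apply: lerD.
  rewrite -RintegralZl //; last exact: continuous_itv_integrable.
  apply: le_Rintegral => //.
  - exact: continuous_itv_integrable.
  - apply: continuous_itv_integrable.
    by apply: continuous_funM => //; exact: continuous_fun_cst.
  move=> s /=; rewrite in_itv /= => /andP[s0 st].
  by rewrite mulrC ler_wpM2r // sigma_ext_anti //; lra.
apply: le_Rintegral => //.
- exact: continuous_itv_integrable.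
- exact: continuous_itv_integrable.
move=> s /=; rewrite in_itv /= => /andP[s0 st].
by rewrite ler_piMr // sigma_ext_le1.
Qed.

Lemma sigma_convolution_cvg0 (S : R) :
  (forall t, 0 <= t -> \int[mu]_(s in `[0, t]) e s <= S) ->
  forall h, 0 < h -> exists M : R, forall t, M <= t ->
    \int[mu]_(s in `[0, t]) (e s * sigma_ext (t - s)) <= h.
Proof.
move=> HS h h0.
pose J t := \int[mu]_(s in `[0, t]) e s.
have S0 : 0 <= S by apply: le_trans (HS 0 (lexx 0)); exact: Rintegral_ge0.
pose A : set R := [set J t | t in [set t | 0 <= t]].
have supA : has_sup A.
  split; first by exists (J 0); exists 0 => //=; exact: lexx.
  by exists S => _ [t /= t0 <-]; exact: HS.
have h20 : 0 < h / 2 by rewrite divr_gt0.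
have [_ [M /= M0 <-] HM] := sup_adherent h20 supA.
have hS0 : 0 < h / 2 / (S + 1) by rewrite divr_gt0 // ltr_wpDl.
have [Y Y0 HY] := sigma_ext_small hS0.
exists (2 * (M + Y)) => t tM.
have t0 : 0 <= t by lra.
have h0' : 0 <= t / 2 by lra.
have ht : t / 2 <= t by lra.
have Mt : M <= t / 2 by lra.
apply: (le_trans (sigma_convolution_le t0)).
rewrite [h]splitr; apply: lerD.
  apply: (@le_trans _ _ (h / 2 / (S + 1) * (S + 1))); last first.
    by rewrite divfK // gt_eqF // ltr_wpDl.
  apply: ler_pM; [exact: sigma_ext_ge0|exact: Rintegral_ge0|by apply: HY; lra|].
  by apply: (le_trans (HS _ h0')); rewrite lerDl.
rewrite -(Rintegral_segmentB ce h0' ht) -/(J t) -/(J (t / 2)).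
have JM : J M <= J (t / 2).
  rewrite -subr_ge0 /J Rintegral_segmentB //; exact: Rintegral_ge0.
have : J t <= sup A by apply: ub_le_sup; [exact: supA.2|exists t].
lra.
Qed.

End bound_rate_bounds.

(** * The velocity estimate *)

Lemma Rintegral_segment_le_halfline {R : realType} (eps : R -> R) :
  {within `[0, +oo[, continuous eps} ->
  (forall t : R, 0 <= t -> 0 <= eps t) -> integrable_halfline eps ->
  forall t, 0 <= t -> \int[lebesgue_measure]_(s in `[0, t]) eps `|s| <=
     \int[lebesgue_measure]_(s in `[0, +oo[) eps s.
Proof.
move=> ceps eps0 ieps t t0.
have ce := continuous_even_extension ceps.
have mH : measurable (`[0%R, +oo[%classic : set R) by exact: measurable_itv.
have me : measurable_fun (`[0%R, +oo[%classic : set R) (fun s => (eps `|s|)%:E).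
  by apply/measurable_EFinP; apply: measurable_funTS; exact: continuous_measurable_fun.
have E : (\int[lebesgue_measure]_(s in `[0%R, +oo[) (eps s)%:E =
  \int[lebesgue_measure]_(s in `[0%R, +oo[) (eps `|s|)%:E)%E.
  apply: eq_integral => s; rewrite inE /= in_itv /= andbT => s0.
  by rewrite ger0_norm.
rewrite /Rintegral E fine_le //.
- by apply: integrable_fin_num => //; exact: continuous_itv_integrable.
- rewrite ge0_fin_numE; first by rewrite -E.
  by apply: integral_ge0 => s _; rewrite lee_fin eps0.
- apply: ge0_subset_integral => //.
  + by move=> s _; rewrite lee_fin eps0.
  + by move=> s /=; rewrite !in_itv /= => /andP[->].
Qed.

Unset Implicit Arguments.
Set Strict Implicit.
Set Printing Implicit Defensive.

Theorem theorem5p1 (R : realType) (X : completeNormedModType R)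
    (T : X -> X) (f : R -> X) (x0 : X) (u : R -> X) (eps : R -> R) (kappa : R) :
  nonexpansive T ->
  {within `[0, +oo[, continuous f} ->
  is_solution T f x0 u ->
  {within `[0, +oo[, continuous eps} ->
  (forall t : R, 0 <= t -> 0 <= eps t) ->
  (forall t : R, 0 <= t -> `|f t| <= eps t) ->
  bounded_range_case T x0 kappa \/ fixed_point_case T x0 eps kappa ->
  (forall t : R, 0 <= t ->
     `|derive_within u t| <=
       kappa * sigma t
       + \int[lebesgue_measure]_(s in `[0, t]) (2 * eps s * sigma (t - s))
       + eps t)
  /\
  (eps t @[t --> +oo] --> (0 : R) ->
   integrable_halfline eps ->
   `|derive_within u t| @[t --> +oo] --> (0 : R)).
Proof.
move=> Tne _ [u0 ueq] ceps eps0 feps cases.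
(* The even extension of [eps] is continuous and nonnegative everywhere. *)
pose e (t : R) := eps `|t|.
have ce : continuous e by exact: continuous_even_extension.
have e0 t : 0 <= e t by exact: eps0.
have eE t : 0 <= t -> e t = eps t by move=> t0; rewrite /e ger0_norm.
have fe t : 0 <= t -> `|f t| <= e t by move=> t0; rewrite eE // feps.
have duE t : 0 <= t -> derive_within u t = f t - (u t - T (u t)).
  by move=> t0; rewrite -(ueq t t0).2 addrK.
have su b c : 0 <= c -> c <= b -> has_slope u 0 b c (f c - (u c - T (u c))).
  move=> c0 cb; rewrite -duE //.
  exact: derivable_within_has_slope (ueq c c0).1.
have Tk t : 0 <= t -> `|T (u t) - u 0| <= kappa.
  move=> t0; rewrite u0; case: cases => [[bT ->]|[[p0 Tp0] _ ieps ->]].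
    apply: ub_le_sup; last by exists (u t).
    case: bT => M [_ HM]; exists (M + 1 + `|x0|) => _ [x _ <-].
    apply: (le_trans (ler_normB _ _)); rewrite lerD2r.
    by apply: (HM (M + 1)); [rewrite ltrDl|exists x].
  (* It suffices to bound [T (u t) - x0] by [2 |x0 - p| + S] for every fixed point
     [p], and then to take the infimum over [p]. *)
  set S := \int[lebesgue_measure]_(t in _) eps t.
  rewrite -lerBlDr -ler_pdivrMl // mulrC.
  apply: lb_le_inf; first by exists `|x0 - p0|; exists p0.
  move=> _ [p Tp <-]; rewrite ler_pdivrMr // lerBlDr.
  have H := fixed_point_distance Tne ce e0 fe su Tp t0.
  have HS : prim e t - prim e 0 <= S.
    rewrite /prim Rintegral_segmentB //.
    exact: Rintegral_segment_le_halfline.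
  rewrite u0 in H.
  have -> : T (u t) - x0 = (T (u t) - T p) + (p - x0) by rewrite Tp addrA subrK.
  apply: (le_trans (ler_normD _ _)); rewrite (distrC p).
  by have := Tne (u t) p; lra.
have k0 : 0 <= kappa by exact: le_trans (Tk 0 (lexx 0)).
pose I t := \int[lebesgue_measure]_(s in `[0, t]) (e s * sigma_ext (t - s)).
have bound t : 0 <= t -> `|derive_within u t| <= kappa * sigma t + 2 * I t + eps t.
  move=> t0; rewrite duE //; apply: (le_trans (velocity_le Tne ce e0 fe su Tk t0)).
  by rewrite eE // lerD2r bound_rate_diag_le.
split=> [t t0|cv ieps].
  apply: (le_trans (bound t t0)); rewrite lerD2r lerD2l /I.
  rewrite -RintegralZl //; last first.
    exact: continuous_itv_integrable (@continuous_sigma_convolution R e ce t).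
  rewrite le_eqVlt; apply/orP; left; apply/eqP; apply: eq_Rintegral => s.
  rewrite inE /= in_itv /= => /andP[s0 st].
  by rewrite eE // sigmaE ?subr_ge0 // mulrA.
have JS t : 0 <= t -> \int[lebesgue_measure]_(s in `[0, t]) e s <=
    \int[lebesgue_measure]_(s in `[0, +oo[) eps s.
  by move=> t0; exact: Rintegral_segment_le_halfline.
apply/cvgrPdist_le => h h0.
have k1 : 0 < kappa + 1 by rewrite ltr_wpDl.
have h1 : 0 < h / 4 / (kappa + 1) by rewrite !divr_gt0.
have [Y Y0 HY] := sigma_ext_small h1.
have h40 : 0 < h / 4 by rewrite divr_gt0.
have [M HM] := sigma_convolution_cvg0 ce e0 JS h40.
move/cvgrPdist_le : cv => /(_ _ h40) cv.
near=> t.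
have t0 : 0 <= t by near: t; exact: nbhs_pinfty_ge (num_real _).
have tY : Y <= t by near: t; exact: nbhs_pinfty_ge (num_real _).
have tM : M <= t by near: t; exact: nbhs_pinfty_ge (num_real _).
have et : `|0 - eps t| <= h / 4 by near: t.
rewrite sub0r !normrN normr_id; apply: (le_trans (bound t t0)).
have I4 : I t <= h / 4 by exact: HM.
have K4 : kappa * sigma t <= h / 4.
  apply: (@le_trans _ _ ((kappa + 1) * (h / 4 / (kappa + 1)))).
    apply: ler_pM => //; rewrite ?sigmaE ?sigma_ext_ge0 ?HY //.
    by rewrite lerDl.
  by rewrite mulrC divfK // gt_eqF.
move: et; rewrite sub0r normrN ger0_norm ?eps0 // => et; lra.
Unshelve. all: by end_near. Qed.
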